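(* There exists a constant $\mu>0$ such that the following holds for all sufficiently large $n$. For every $n$-vertex graph $G$ of minimum degree at least $\frac{n}{2}$ and every $\mu n$-bounded incompatibility system $\mathcal{F}$ over $G$, there exists a Hamilton cycle in $G$ that is compatible with $\mathcal{F}$.
   Context: All graphs are finite and simple. Let $G=(V,E)$ be a graph. An incompatibility system $\mathcal{F}$ over $G$ is a family $\mathcal{F}=\{F_v\}_{v\in V}$ where, for every $v\in V$, $F_v$ is a set of unordered pairs $\{e,e'\}$ of distinct edges $e,e'\in E$ with $e\cap e'=\{v\}$. Two edges $e,e'$ are incompatible (in $\mathcal{F}$) if $\{e,e'\}\in F_v$ for some vertex $v$, and compatible otherwise. A subgraph $H\subseteq G$ (e.g. a cycle) is compatible with $\mathcal{F}$ if every pair of its edges is compatible. For a positive real $\Delta$, $\mathcal{F}$ is $\Delta$-bounded if for every vertex $v$ and every edge $e$ incident to $v$, there are at most $\Delta$ other edges $e'$ incident to $v$ with $\{e,e'\}\in F_v$. *)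

(* Defs.v *)
From mathcomp Require Import all_boot.
From Stdlib Require Import Reals.
Set Implicit Arguments. Unset Strict Implicit. Unset Printing Implicit Defensive.

Definition simple_graph n (adj : rel 'I_n) : Prop :=
  (forall x y, adj x y = adj y x) /\ (forall x, ~~ adj x x).

Definition deg n (adj : rel 'I_n) (v : 'I_n) : nat := #|[set u | adj v u]|.

(* An incompatibility system over G: F v u w means the edges vu and vw
   form an incompatible pair at v, i.e. {vu, vw} \in F_v.  Since the pair is
   unordered, F v is symmetric; the edges must be distinct edges of G meeting
   exactly in v. *)
Definition incompat_system n (adj : rel 'I_n) (F : 'I_n -> rel 'I_n) : Prop :=
  (forall v u w, F v u w = F v w u) /\
  (forall v u w, F v u w -> [&& adj v u, adj v w & u != w]).

Definition delta_bounded n (F : 'I_n -> rel 'I_n) (Delta : R) : Prop :=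
  forall v u, (INR #|[set w | F v u w]| <= Delta)%R.

Definition hamilton_cycle n (adj : rel 'I_n) (s : seq 'I_n) : Prop :=
  [/\ 3 <= n, size s = n, uniq s & cycle adj s].

(* Compatibility of a cycle (length >= 3): two distinct edges of the cycle
   sharing a vertex are the two edges at that vertex, prev(v)v and v next(v). *)
Definition compatible_cycle n (F : 'I_n -> rel 'I_n) (s : seq 'I_n) : Prop :=
  forall v, v \in s -> ~~ F v (prev s v) (next s v).

(* Main.v *)
(**
  Take a cyclic order of all vertices, not necessarily a cycle of the graph, with
  the fewest defects, a defect being a consecutive non-edge or an incompatible pair
  of consecutive edges; zero defects means a compatible Hamilton cycle.  Removing a
  defective pair [y x] leaves a path from [x] to [y], which is closed up again after
  exchanging two more pairs for two new ones.  Incompatibility is local and bounded, so if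
  there are quadratically many ways of doing so, one of them removes the defect and
  creates no new one, except possibly at the new neighbours [z] of [x] and [c] of
  [y], which can be chosen so that a further exchange repairs them.

  If some order admits few exchanges, then following the neighbourhoods of the
  rotated end points forces the graph to be close to two disjoint cliques or to a
  balanced complete bipartite graph.  There one fixes a few disjoint edges (two
  edges between the cliques, respectively a matching inside the larger class) and
  only exchanges edges that respect the partition, recorded by a relation [K]; such
  exchanges are always plentiful, with no sharp threshold involved.
*)
Require Import Defs.
From mathcomp Require Import all_boot zify.
Set Implicit Arguments. Unset Strict Implicit. Unset Printing Implicit Defensive.

(** * Cyclic orders and switches *)

(** For an edge [vu] the bound on the system limits the conflicting partners at the same vertex [v].
    For a fixed [x] it says nothing about the number of vertices [v] at which [vx] conflicts with an
    edge of the order. That number, [load s x], may be linear in the number of vertices, so every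
    candidate for a new edge [xz] may conflict at [z]. On average over [x], however, the load is at
    most twice the bound. So [z] and its neighbour can be chosen with small load, and a conflict at
    [z] is then removed by a switch that breaks the pair between them and creates nothing new.

    All quantities tracked (defects, pairs outside [K], loads, even the neighbours of a given
    vertex) are sums over the vertices of a function of the vertex and its two neighbours in the
    order. One identity, valid for every such function, therefore describes a switch completely. *)

Section Triples.
Variable T : eqType.
Implicit Types (f : T -> T -> T -> nat) (s : seq T).

(** Switches reverse segments, so only statistics invariant under reversal can be tracked. *)
Definition mirror f := forall a v b, f a v b = f b v a.

Definition at_vertex f s v := f (prev s v) v (next s v).

Definition tri (x0 : T) f s :=
  \sum_(i < size s - 2) f (nth x0 s i) (nth x0 s i.+1) (nth x0 s i.+2).

Lemma next_nthS x0 s i : uniq s -> i.+1 < size s ->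
  next s (nth x0 s i) = nth x0 s i.+1.
Proof.
move=> us hi; rewrite next_nth mem_nth 1?ltnW //.
case: s us hi => // y p us hi; rewrite index_uniq //; last exact: ltnW.
by rewrite /=; apply: set_nth_default.
Qed.

Lemma prev_nthS x0 s i : uniq s -> i.+1 < size s ->
  prev s (nth x0 s i.+1) = nth x0 s i.
Proof. by move=> us hi; rewrite -(next_nthS x0 us hi) prev_next. Qed.

Lemma prev_nthP x0 s i : uniq s -> 0 < i -> i < size s ->
  prev s (nth x0 s i) = nth x0 s i.-1.
Proof. by case: i => // i us _; exact: prev_nthS. Qed.

Lemma next_last x0 s : uniq s -> 0 < size s ->
  next s (last x0 s) = head x0 s.
Proof.
case: s => // y p us _; rewrite [last _ _]/= next_nth mem_last (last_nth x0).
by rewrite index_uniq //= nth_default.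
Qed.

Lemma prev_head x0 s : uniq s -> 0 < size s ->
  prev s (head x0 s) = last x0 s.
Proof. by move=> us hs; rewrite -(next_last x0) // prev_next. Qed.

(** Since [next s] permutes [s], the sum may run over the middle entries of triples; the first two
    entries are repeated at the end to supply the triples that wrap around. *)
Lemma at_vertex_sumE x0 f s : uniq s -> 1 < size s ->
  \sum_(v <- s) at_vertex f s v = tri x0 f (s ++ take 2 s).
Proof.
move=> us hs; rewrite -(big_map (fun v => v) xpredT (at_vertex f s)) map_id.
have h2: size (take 2 s) = 2 by rewrite size_takel.
rewrite /tri size_cat h2 addnK.
have nx i : i < size s -> next s (nth x0 s i) = nth x0 (s ++ take 2 s) i.+1.
  move=> hi; rewrite nth_cat; case: ltnP => hi'; first exact: next_nthS.
  have ei : i = (size s).-1 by lia.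
  rewrite ei nth_last next_last //; last lia.
  by rewrite prednK ?subnn ?nth_take ?nth0 //; lia.
have pm : perm_eq (map (next s) s) s.
  apply: uniq_perm => //; first by rewrite map_inj_uniq // => x y /(can_inj (prev_next us)).
  move=> x; apply/mapP/idP => [[y ys ->]|xs]; first by rewrite mem_next.
  by exists (prev s x); rewrite ?mem_prev // next_prev.
rewrite -(perm_big _ pm) /= big_map (big_nth x0) big_mkord.
apply: eq_bigr => i _; rewrite /at_vertex prev_next //.
have hi := ltn_ord i.
rewrite nth_cat hi nx //; congr f.
rewrite nth_cat; case: ltnP => hi1.
  by rewrite nx.
have ei : i.+1 = size s by lia.
rewrite ei subnn nth_take // nth_cat ltnNge leqnSn /= subSnn nth_take //.
by rewrite -(next_nthS x0 us) //.
Qed.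

Lemma tri_cat x0 f (u v : seq T) : 1 < size u -> 1 < size v ->
  tri x0 f (u ++ v) = tri x0 f u
    + f (nth x0 u (size u).-2) (nth x0 u (size u).-1) (nth x0 v 0)
    + f (nth x0 u (size u).-1) (nth x0 v 0) (nth x0 v 1) + tri x0 f v.
Proof.
move=> hu hv; rewrite /tri size_cat.
have -> : size u + size v - 2 = (size u - 2) + (2 + (size v - 2)) by lia.
rewrite big_split_ord /= big_split_ord /= !big_ord_recl big_ord0 addn0.
rewrite !addnA; congr (_ + _ + _ + _).
- by apply: eq_bigr => i _; have hi := ltn_ord i; rewrite !nth_cat !ifT //; lia.
- have [k ek] : {k | size u = k.+2} by exists (size u).-2; lia.
  rewrite !nth_cat ek /= addn0 subSS subSS subn0.
  have -> : k < k.+2 by lia.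
  by rewrite ltnSn ltnn subnn.
- have [k ek] : {k | size u = k.+2} by exists (size u).-2; lia.
  rewrite !nth_cat ek /= /bump /= subSS subSS subn0 !addn0 !addn1.
  have -> : (k.+3 < k.+2) = false by lia.
  by rewrite ltnSn ltnn subnn subSnn.
- apply: eq_bigr => i _; rewrite !nth_cat !ifF; [|lia..].
  congr f; congr nth; lia.
Qed.

Lemma tri_rev x0 f (u : seq T) : mirror f -> tri x0 f (rev u) = tri x0 f u.
Proof.
move=> hf; rewrite /tri size_rev (reindex_inj rev_ord_inj) /=.
apply: eq_bigr => i _; have hi := ltn_ord i.
rewrite !nth_rev; [|lia..]; rewrite hf.
congr f; congr nth; lia.
Qed.

Lemma tri2 x0 f a b : tri x0 f [:: a; b] = 0.
Proof. by rewrite /tri big_ord0. Qed.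

Lemma nth_rev_first x0 (u : seq T) : 1 < size u ->
  (nth x0 (rev u) 0 = nth x0 u (size u).-1) * (nth x0 (rev u) 1 = nth x0 u (size u).-2) *
  (nth x0 (rev u) (size u).-1 = nth x0 u 0) * (nth x0 (rev u) (size u).-2 = nth x0 u 1).
Proof. by move=> hu; rewrite !nth_rev; [split; [split; [split|]|]; congr nth; lia|lia..]. Qed.

Lemma tri_cycle3 x0 f (u v w : seq T) : 1 < size u -> 1 < size v -> 1 < size w ->
  tri x0 f ((u ++ v ++ w) ++ take 2 (u ++ v ++ w)) =
    tri x0 f u + tri x0 f v + tri x0 f w
    + f (nth x0 u (size u).-2) (nth x0 u (size u).-1) (nth x0 v 0)
    + f (nth x0 u (size u).-1) (nth x0 v 0) (nth x0 v 1)
    + f (nth x0 v (size v).-2) (nth x0 v (size v).-1) (nth x0 w 0)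
    + f (nth x0 v (size v).-1) (nth x0 w 0) (nth x0 w 1)
    + f (nth x0 w (size w).-2) (nth x0 w (size w).-1) (nth x0 u 0)
    + f (nth x0 w (size w).-1) (nth x0 u 0) (nth x0 u 1).
Proof.
move=> hu hv hw.
have -> : take 2 (u ++ v ++ w) = [:: nth x0 u 0; nth x0 u 1].
  by case: u hu => [|a [|b u]] //= _; rewrite take0.
rewrite -!catA !tri_cat ?size_cat //=; try lia.
rewrite tri2 !nth_cat !ifT ?sub0n; lia.
Qed.

(** The order is cut after positions [i], [j] and [m], and the three segments are joined again in
    two ways. Each segment has at least two entries, so no triple meets all three. The old terms
    stand on the left to avoid truncated subtraction, and [s'] is chosen before [f], so one order
    serves all statistics. *)
Lemma switch_nth x0 s i j : uniq s -> 0 < i -> i.+1 < j -> j.+2 < size s ->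
  let p := nth x0 s in let m := (size s).-1 in
  let old f := f (p i.-1) (p i) (p i.+1) + f (p i) (p i.+1) (p i.+2) +
    f (p j.-1) (p j) (p j.+1) + f (p j) (p j.+1) (p j.+2) +
    f (p m.-1) (p m) (p 0) + f (p m) (p 0) (p 1) in
  let new1 f := f (p i.-1) (p i) (p j.+1) + f (p i) (p j.+1) (p j.+2) +
    f (p m.-1) (p m) (p j) + f (p m) (p j) (p j.-1) +
    f (p i.+2) (p i.+1) (p 0) + f (p i.+1) (p 0) (p 1) in
  let new2 f := f (p i.-1) (p i) (p j) + f (p i) (p j) (p j.-1) +
    f (p i.+2) (p i.+1) (p m) + f (p i.+1) (p m) (p m.-1) +
    f (p j.+2) (p j.+1) (p 0) + f (p j.+1) (p 0) (p 1) in
  (exists s', perm_eq s' s /\ forall f, mirror f ->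
    \sum_(v <- s') at_vertex f s' v + old f = \sum_(v <- s) at_vertex f s v + new1 f) /\
  (exists s', perm_eq s' s /\ forall f, mirror f ->
    \sum_(v <- s') at_vertex f s' v + old f = \sum_(v <- s) at_vertex f s v + new2 f).
Proof.
move=> us i0 ij jn p m old new1 new2.
set s1 := take i.+1 s; set s2 := drop i.+1 (take j.+1 s); set s3 := drop j.+1 s.
have es : s = s1 ++ s2 ++ s3.
  rewrite catA /s1 -(take_takel s (_ : i.+1 <= j.+1)); last lia.
  by rewrite cat_take_drop cat_take_drop.
have z1 : size s1 = i.+1 by rewrite size_takel //; clear -ij jn; lia.
have z2 : size s2 = j - i by rewrite size_drop size_takel //; clear -ij jn; lia.
have z3 : size s3 = size s - j.+1 by rewrite size_drop.
have p1 k : k <= i -> nth x0 s1 k = p k by move=> hk; rewrite nth_take.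
have p2 k : k < j - i -> nth x0 s2 k = p (i.+1 + k).
  by move=> hk; rewrite nth_drop nth_take //; lia.
have p3 k : nth x0 s3 k = p (j.+1 + k) by rewrite nth_drop.
have g1 : 1 < size s1 by lia.
have g2 : 1 < size s2 by lia.
have g3 : 1 < size s3 by lia.
have q1 : i.+1 + 1 = i.+2 by lia.
have q2 : j.+1 + 1 = j.+2 by lia.
have q3 : i.+1 + (j - i).-1 = j by clear -ij; lia.
have q4 : i.+1 + (j - i).-2 = j.-1 by clear -ij; lia.
have q5 : j.+1 + (size s - j.+1).-1 = (size s).-1 by clear -jn; lia.
have q6 : j.+1 + (size s - j.+1).-2 = (size s).-2 by clear -jn; lia.
have q7 : (j - i).-1 < j - i by clear -ij; lia.
have q8 : (j - i).-2 < j - i by clear -ij; lia.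
have q9 : 0 < j - i by clear -ij; lia.
have q10 : 1 < j - i by clear -ij; lia.
have q11 : i.-1 <= i by clear; lia.
have eqs := (addn0, q1, q2, q3, q4, q5, q6).
have sum_old f : \sum_(v <- s) at_vertex f s v = tri x0 f s1 + tri x0 f s2 + tri x0 f s3 + old f.
  rewrite (at_vertex_sumE x0) //; last lia.
  rewrite [in LHS]es tri_cycle3 // z1 z2 z3 /= !p3 !p1 //.
  rewrite !p2 // /old /m.
  rewrite !eqs; clear; lia.
split.
  (* Joins [p i] to [p j.+1], [p m] to [p j] and [p i.+1] to [p 0]. *)
  exists (s1 ++ s3 ++ rev s2).
  have pm : perm_eq (s1 ++ s3 ++ rev s2) s.
    by rewrite [X in perm_eq _ X]es perm_cat2l perm_catC perm_cat2r perm_rev.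
  split=> // f hf; rewrite sum_old (at_vertex_sumE x0) ?(perm_uniq pm) ?(perm_size pm) //; last lia.
  rewrite tri_cycle3 ?size_rev // tri_rev // !nth_rev_first // z1 z2 z3 /= !p3 !p1 //.
  rewrite !p2 // /new1 /m.
  rewrite !eqs; clear; lia.
(* Joins [p i] to [p j], [p i.+1] to [p m] and [p j.+1] to [p 0]. *)
exists (s1 ++ rev s2 ++ rev s3).
have pm : perm_eq (s1 ++ rev s2 ++ rev s3) s.
  by rewrite [X in perm_eq _ X]es perm_cat2l perm_cat // perm_rev.
split=> // f hf; rewrite sum_old (at_vertex_sumE x0) ?(perm_uniq pm) ?(perm_size pm) //; last lia.
rewrite tri_cycle3 ?size_rev // !tri_rev // !nth_rev_first // z1 z2 z3 /= !p3 !p1 //.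
rewrite !p2 // /new2 /m.
rewrite !eqs; clear; lia.
Qed.

End Triples.

Lemma card_leqD (T : finType) (A B : {set T}) : #|A| <= #|A :\: B| + #|B|.
Proof. by rewrite cardsD; have := subset_leq_card (subsetIr A B); lia. Qed.

(** * Counting pairs through their fibres *)

Section Counting.
Variable T : finType.
Implicit Types (Q : rel T) (U : {set T}).

Lemma card_fiberl Q k : (forall a, #|[set c | Q a c]| <= k) ->
  #|[set p : T * T | Q p.1 p.2]| <= #|T| * k.
Proof.
move=> h; rewrite -sum1dep_card -(pair_big_dep xpredT Q (fun _ _ => 1)) /=.
rewrite -sum_nat_const.
by apply: leq_sum => a _; rewrite sum1dep_card.
Qed.

Lemma card_fiberr Q k : (forall c, #|[set a | Q a c]| <= k) ->
  #|[set p : T * T | Q p.1 p.2]| <= #|T| * k.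
Proof.
move=> h; have sw : injective (fun p : T * T => (p.2, p.1)) by move=> [? ?] [? ?] [-> ->].
rewrite -(card_imset _ sw).
apply: leq_trans (card_fiberl (fun c => h c)); apply: subset_leq_card.
by apply/subsetP => _ /imsetP[[a c] hac ->]; move: hac; rewrite !inE.
Qed.

Lemma card_preim_inj (g : T -> T) U : injective g -> #|[set a | g a \in U]| <= #|U|.
Proof.
move=> gi; rewrite -(card_imset _ gi); apply: subset_leq_card.
by apply/subsetP => _ /imsetP[a ha ->]; rewrite inE in ha.
Qed.

(** Union bound: the relations are deleted from [P] one after the other, each at a cost of at most
    [k] pairs. *)
Lemma avoid_bad (P : {set T * T}) (Qs : seq (rel T)) k :
  foldr (fun Q acc => #|[set p : T * T | Q p.1 p.2]| <= k /\ acc) True Qs ->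
  size Qs * k < #|P| ->
  exists a c, (a, c) \in P /\ all (fun Q : rel T => ~~ Q a c) Qs.
Proof.
elim: Qs P => [|Q Qs IH] P /=.
  by rewrite mul0n card_gt0 => _ /set0Pn[[a c] h]; exists a, c.
move=> [hQ hQs]; rewrite mulSn => hP.
have hP' : size Qs * k < #|P :\: [set p : T * T | Q p.1 p.2]|.
  have := leq_trans hP (leq_trans (card_leqD P _) (leq_add (leqnn _) hQ)).
  by rewrite addnC ltn_add2r.
have [a [c []]] := IH _ hQs hP'.
by rewrite !inE /= => /andP[h1 h2] h3; exists a, c; rewrite h1.
Qed.

Lemma card_leq_sum (g : T -> nat) U : (forall v, v \in U -> 0 < g v) -> #|U| <= \sum_v g v.
Proof.
move=> h; rewrite -sum1_card big_mkcond /=; apply: leq_sum => v _.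
by case: ifP => // /h.
Qed.

End Counting.

Lemma next_neq (T : eqType) (s : seq T) v : uniq s -> 1 < size s -> v \in s -> next s v != v.
Proof.
move=> us hs vs; have i0 : 0 < size s by lia.
have hi : index v s < size s by rewrite index_mem.
rewrite -[in next _ _](nth_index v vs).
case: (ltnP (index v s).+1 (size s)) => hi1.
  by rewrite next_nthS // -[X in _ != X](nth_index v vs) nth_uniq //; lia.
have ei : index v s = (size s).-1 by lia.
rewrite ei nth_last next_last // -nth0 -[X in _ != X](nth_index v vs) nth_uniq //; lia.
Qed.

(** * The effect of a switch at each vertex *)

Section Switch.
Variable T : finType.
Variable x0 : T.
Implicit Types (f : T -> T -> T -> nat) (s : seq T).

Lemma sum_at_vertexE f s : perm_eq s (enum T) -> \sum_v at_vertex f s v = \sum_(v <- s) at_vertex f s v.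
Proof. by move=> hs; rewrite (perm_big _ hs) /= big_enum. Qed.

Section OneSwitch.
Variables (s : seq T) (a c : T).
Let x := head x0 s.
Let y := last x0 s.
Let z := next s a.
(** [b] is the neighbour that [c] loses, on the side away from [a]; [c'] and [b'] are the neighbours
    that [c] and [b] keep. *)
Let t := index c s <= index a s.
Let b := if t then prev s c else next s c.
Let c' := if t then next s c else prev s c.
Let b' := if t then prev s b else next s b.
Hypothesis ps : perm_eq s (enum T).
(** These exclusions give each of the three segments at least two entries. *)
Hypotheses (ax : a != x) (ay : a != y) (ay' : a != prev s y).
Hypotheses (cx : c != x) (cy : c != y) (cx' : c != next s x) (cy' : c != prev s y).
Hypotheses (ca : c != a) (cz : c != z).

Lemma switch_sum : exists s', perm_eq s' (enum T) /\ forall f, mirror f ->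
  \sum_v at_vertex f s' v + (f (prev s a) a z + f a z (next s z) + f c' c b + f c b b'
     + f (prev s y) y x + f y x (next s x))
  = \sum_v at_vertex f s v + (f (prev s a) a b + f a b b' + f (prev s y) y c + f y c c'
     + f (next s z) z x + f z x (next s x)).
Proof.
have us : uniq s by rewrite (perm_uniq ps) enum_uniq.
have ms v : v \in s by rewrite (perm_mem ps) mem_enum.
set n := size s.
have ia : index a s < n by rewrite index_mem.
have ic : index c s < n by rewrite index_mem.
have ea : a = nth x0 s (index a s) by rewrite nth_index.
have ec : c = nth x0 s (index c s) by rewrite nth_index.
have n0 : 0 < n by rewrite (leq_trans _ ia).
have ex : x = nth x0 s 0 by rewrite nth0.
have ey : y = nth x0 s n.-1 by rewrite nth_last.
have i0 : index a s != 0 by apply: contraNneq ax => h; rewrite ea h ex.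
have j0 : index c s != 0 by apply: contraNneq cx => h; rewrite ec h ex.
have i1 : index a s != n.-1 by apply: contraNneq ay => h; rewrite ea h ey.
have j1 : index c s != n.-1 by apply: contraNneq cy => h; rewrite ec h ey.
have [hn hn1 hn2] : [/\ 1 < n, 0 < n.-1 & n.-1 < n] by clear -ia i0; split; lia.
have [hi hi' hj hj'] : [/\ 0 < index a s, (index a s).+1 < n, 0 < index c s & (index c s).+1 < n].
  by clear -i0 j0 ia ic i1 j1; split; lia.
have ex' : next s x = nth x0 s 1 by rewrite ex next_nthS.
have ey' : prev s y = nth x0 s n.-2 by rewrite ey prev_nthP.
have i2 : index a s != n.-2 by apply: contraNneq ay' => h; rewrite ea h ey'.
have j2 : index c s != n.-2 by apply: contraNneq cy' => h; rewrite ec h ey'.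
have j3 : index c s != 1 by apply: contraNneq cx' => h; rewrite ec h ex'.
have ij : index c s != index a s by apply: contraNneq ca => h; rewrite ec h -ea.
have ez : z = nth x0 s (index a s).+1 by rewrite /z {1}ea next_nthS.
have ij1 : index c s != (index a s).+1 by apply: contraNneq cz => h; rewrite ec h -ez.
have [ki kj] : (index a s).+2 < n /\ (index c s).+2 < n by clear -hi' hj' i2 j2; lia.
have [kj' kn] : 0 < (index c s).-1 /\ (index c s).-1 < n by clear -j0 j3 ic; lia.
have ez' : next s z = nth x0 s (index a s).+2 by rewrite ez next_nthS.
have ea' : prev s a = nth x0 s (index a s).-1 by rewrite {1}ea prev_nthP.
have enc : next s c = nth x0 s (index c s).+1 by rewrite {1}ec next_nthS.
have enc' : next s (next s c) = nth x0 s (index c s).+2 by rewrite enc next_nthS.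
have epc : prev s c = nth x0 s (index c s).-1 by rewrite {1}ec prev_nthP.
have epc' : prev s (prev s c) = nth x0 s (index c s).-2 by rewrite epc prev_nthP.
rewrite /b' /b /c'; case: ifP; rewrite /t => ht.
  have [|||_ [s' [ps' H]]] := @switch_nth _ x0 s (index c s).-1 (index a s) us.
  - by clear -j0 j3; lia.
  - by clear -ht ij j0; lia.
  - exact: ki.
  exists s'; split; first exact: perm_trans ps' ps.
  move=> f hf; rewrite !sum_at_vertexE //; last exact: perm_trans ps' ps.
  have := H f hf; rewrite -/n prednK; last by clear -j0; lia.
  rewrite -ex -ey -ey' -ex' -ez -ez' -ea' -ea -epc' -epc -ec -enc.
  rewrite (hf a _ (prev s (prev s c))) (hf c (prev s c)) (hf (next s c) c (prev s c)).
  rewrite (hf y c) (hf (prev s y) y c) (hf (prev s a) a (prev s c)).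
  have ac A B o1 o2 o3 o4 o5 o6 n1 n2 n3 n4 n5 n6 :
    A + (o1 + o2 + o3 + o4 + o5 + o6) = B + (n1 + n2 + n3 + n4 + n5 + n6) ->
    A + (o3 + o4 + o2 + o1 + o5 + o6) = B + (n2 + n1 + n4 + n3 + n5 + n6).
    by clear; lia.
  exact: ac.
have [|||[s' [ps' H]] _] := @switch_nth _ x0 s (index a s) (index c s) us.
- by clear -i0; lia.
- by clear -ht ij ij1; lia.
- exact: kj.
exists s'; split; first exact: perm_trans ps' ps.
move=> f hf; rewrite !sum_at_vertexE //; last exact: perm_trans ps' ps.
have := H f hf; rewrite -/n.
rewrite -ex -ey -ey' -ex' -ez -ez' -ea' -ea -epc -ec -enc -enc'; exact: id.
Qed.

(** Multiplying [f] by the indicator that the middle entry is [v] gives another mirror function, so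
    the identity between sums already determines the value at every single vertex. *)
Lemma switch_pointwise : uniq [:: a; z; c; b; x; y] ->
  exists s', perm_eq s' (enum T) /\ forall f, mirror f ->
  [/\ forall v, v \notin [:: a; z; c; b; x; y] -> at_vertex f s' v = at_vertex f s v,
      at_vertex f s' a = f (prev s a) a b, at_vertex f s' b = f a b b',
      at_vertex f s' y = f (prev s y) y c &
      [/\ at_vertex f s' c = f y c c', at_vertex f s' z = f (next s z) z x & at_vertex f s' x = f z x (next s x)]].
Proof.
have us : uniq s by rewrite (perm_uniq ps) enum_uniq.
have s0 : 0 < size s by rewrite (perm_size ps) -cardT; apply/card_gt0P; exists x0.
move=> /=; rewrite !inE !negb_or !andbT.
move=> /and5P[/and5P[n1 n2 n3 n4 n5] /and4P[n6 n7 n8 n9] /and3P[n10 n11 n12] /andP[n13 n14] n15].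
have [s' [ps' H]] := switch_sum; exists s'; split=> // f hf.
have key v : at_vertex f s' v + ((a == v) * f (prev s a) a z + (z == v) * f a z (next s z)
    + (c == v) * f c' c b + (b == v) * f c b b'
    + (y == v) * f (prev s y) y x + (x == v) * f y x (next s x))
  = at_vertex f s v + ((a == v) * f (prev s a) a b + (b == v) * f a b b' + (y == v) * f (prev s y) y c
     + (c == v) * f y c c' + (z == v) * f (next s z) z x + (x == v) * f z x (next s x)).
  have hg : mirror (fun p u q => (u == v) * f p u q) by move=> p u q; rewrite hf.
  have one r : \sum_u at_vertex (fun p u q => (u == v) * f p u q) r u = at_vertex f r v.
    rewrite (bigD1 v) //= big1 ?addn0 /at_vertex ?eqxx ?mul1n // => u /negbTE ->; exact: mul0n.
  by have := H _ hg; rewrite !one.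
have Ea : at_vertex f s a = f (prev s a) a z by [].
have Ez : at_vertex f s z = f a z (next s z) by rewrite /at_vertex prev_next.
have Ey : at_vertex f s y = f (prev s y) y x by rewrite /at_vertex next_last.
have Ex : at_vertex f s x = f y x (next s x) by rewrite /at_vertex prev_head.
have Ec : at_vertex f s c = f c' c b by rewrite /at_vertex /c' /b; case: ifP => _ //; rewrite hf.
have Eb : at_vertex f s b = f c b b'.
  by rewrite /at_vertex /b' /b; case: ifP => _; rewrite ?prev_next ?next_prev // hf.
have nE := (negbTE n1, negbTE n2, negbTE n3, negbTE n4, negbTE n5, negbTE n6, negbTE n7,
  negbTE n8, negbTE n9, negbTE n10, negbTE n11, negbTE n12, negbTE n13, negbTE n14, negbTE n15).
have sy (u v : T) : u != v -> (v == u) = false by rewrite eq_sym => /negbTE.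
have nE' := (sy _ _ n1, sy _ _ n2, sy _ _ n3, sy _ _ n4, sy _ _ n5, sy _ _ n6, sy _ _ n7,
  sy _ _ n8, sy _ _ n9, sy _ _ n10, sy _ _ n11, sy _ _ n12, sy _ _ n13, sy _ _ n14, sy _ _ n15).
split.
- move=> v; rewrite !inE !negb_or => /and5P[v1 v2 v3 v4 /andP[v5 v6]].
  have := key v; rewrite ![_ == v]eq_sym (negbTE v1) (negbTE v2) (negbTE v3) (negbTE v4).
  by rewrite (negbTE v5) (negbTE v6) !mul0n !addn0.
- by have := key a; rewrite eqxx !nE' !mul0n mul1n Ea; clear; lia.
- by have := key b; rewrite eqxx !nE' !nE !mul0n mul1n Eb; clear; lia.
- by have := key y; rewrite eqxx !nE !mul0n mul1n Ey; clear; lia.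
split.
- by have := key c; rewrite eqxx !nE' !nE !mul0n mul1n Ec; clear; lia.
- by have := key z; rewrite eqxx !nE' !nE !mul0n mul1n Ez; clear; lia.
- by have := key x; rewrite eqxx !nE' !nE !mul0n mul1n Ex; clear; lia.
Qed.

End OneSwitch.
End Switch.

(** * Removing defects *)

Section Descent.
Variables (T : finType) (x0 : T) (adj K : rel T) (F : T -> rel T).
Hypothesis adj_sym : symmetric adj.
Hypothesis K_sym : symmetric K.
Hypothesis F_sym : forall v u w, F v u w = F v w u.
Implicit Types (s : seq T) (U : {set T}).

(** A non-edge is counted at both of its ends, a conflict only at its vertex. *)
Definition defect a v b : nat := F v a b + ~~ adj v a + ~~ adj v b.
(* Vanishes at every vertex iff the pairs of the order outside [K] are edges of
   [adj] and form a matching. *)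
Definition improper a v b : nat :=
  ~~ (K v a || K v b) + ~~ (K v a || adj v a) + ~~ (K v b || adj v b).
Definition nonK a v b : nat := ~~ K v a + ~~ K v b.
(** Counts the pairs of the order at [v] that are incompatible there with [vu]; [u] need not be near
    [v] in the order. *)
Definition clash u a v b : nat := F v u a + F v u b.

Definition weight s := \sum_v at_vertex defect s v.
Definition load s u := \sum_v at_vertex (clash u) s v.

Definition valid m s :=
  [/\ perm_eq s (enum T), forall v, at_vertex improper s v = 0 & \sum_v at_vertex nonK s v <= m].

(* [(a, c)] encodes the switch that replaces [y x], [a z], [c b] by [x z], [y c],
   [a b]; which neighbour of [c] has to be taken as [b] depends on whether [c]
   comes before [a]. *)
Definition switches s : {set T * T} :=
  [set p | let: (a, c) := p in
    let x := head x0 s in let y := last x0 s in let z := next s a in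
    let b := if index c s <= index a s then prev s c else next s c in
    [&& adj x z, K x z, adj y c, K y c, adj a b, K a b, K a z & K c b]].

(** Only pairs in [K] are ever removed, whence the condition on the closing pair. *)
Definition robust C m :=
  forall s, valid m s -> K (last x0 s) (head x0 s) -> #|T| * #|T| <= C * #|switches s|.

Lemma mirror_defect : mirror defect.
Proof. by move=> a v b; rewrite /defect F_sym; lia. Qed.
Lemma mirror_improper : mirror improper.
Proof. by move=> a v b; rewrite /improper orbC; lia. Qed.
Lemma mirror_nonK : mirror nonK. Proof. by move=> a v b; rewrite /nonK addnC. Qed.
Lemma mirror_clash u : mirror (clash u). Proof. by move=> a v b; rewrite /clash addnC. Qed.

Section Choose.
Variables (s : seq T) (U : {set T}) (C m e : nat).
Let x := head x0 s.
Let y := last x0 s.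
Hypothesis vs : valid m s.
Hypothesis many : #|T| * #|T| <= C * #|switches s|.
Hypotheses (e0 : 0 < e) (me : m <= e) (Ue : #|U| <= e) (eC : 30 * C * e < #|T|).
Hypothesis Fe : forall v u, #|[set w | F v u w]| <= e.

(* Every unwanted property below excludes at most [#|T| * e] of the pairs. *)
Lemma choose_switch : exists a c, (a, c) \in switches s /\
  let z := next s a in
  [/\ [/\ a \notin U, z \notin U & next s z \notin U],
      [/\ c \notin U, next s c \notin U & prev s c \notin U],
      [/\ c != a, c != z, c != next s z, next s c != a & prev s c != z],
      [/\ K z (next s z), K c (next s c) & K c (prev s c)] &
    [/\ [/\ ~~ F a (prev s a) (next s c), ~~ F a (prev s a) (prev s c),
            ~~ F (next s c) (next s (next s c)) a & ~~ F (prev s c) (prev s (prev s c)) a],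
        ~~ F y (prev s y) c, ~~ F x (next s x) z,
        (load s x <= e -> ~~ F z (next s z) x) &
        (load s y <= e -> ~~ F c (next s c) y /\ ~~ F c (prev s c) y)]].
Proof.
have [ps _ nKm] := vs.
have us : uniq s by rewrite (perm_uniq ps) enum_uniq.
have ni : injective (next s) := can_inj (prev_next us).
have pi : injective (prev s) := can_inj (next_prev us).
have nni : injective (fun a => next s (next s a)) by move=> u v /ni /ni.
pose Kn := [set v | ~~ K v (next s v)]; pose Kp := [set v | ~~ K v (prev s v)].
have Kne : #|Kn| <= e.
  apply: leq_trans (leq_trans nKm me); apply: card_leq_sum => v.
  by rewrite inE /at_vertex /nonK => ->; rewrite addn1.
have Kpe : #|Kp| <= e.
  apply: leq_trans (leq_trans nKm me); apply: card_leq_sum => v.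
  by rewrite inE /at_vertex /nonK => ->.
(* With [u] fixed and [v] varying, only the load bounds these sets. If it exceeds [e] they are empty
   and nothing is claimed. *)
pose Ln u := [set v | (load s u <= e) && F v (next s v) u].
pose Lp u := [set v | (load s u <= e) && F v (prev s v) u].
have Lne u : #|Ln u| <= e.
  case: (leqP (load s u) e) => h; last first.
    by rewrite (_ : Ln u = set0) ?cards0 //; apply/setP => v; rewrite !inE leqNgt h.
  apply: leq_trans h; apply: card_leq_sum => v.
  by rewrite inE /at_vertex /clash F_sym => /andP[_ ->]; rewrite addn1.
have Lpe u : #|Lp u| <= e.
  case: (leqP (load s u) e) => h; last first.
    by rewrite (_ : Lp u = set0) ?cards0 //; apply/setP => v; rewrite !inE leqNgt h.
  apply: leq_trans h; apply: card_leq_sum => v.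
  by rewrite inE /at_vertex /clash F_sym => /andP[_ ->].
(* [fl] treats conditions on [c] for given [a], [fr] those on [a] for given [c]. Conditions on [b]
   are imposed on both neighbours of [c]: [next s] and [prev s] are injective, whereas which of them
   gives [b] depends on [a]. *)
have fl (g : T -> T) (V : T -> {set T}) : injective g -> (forall a, #|V a| <= e) ->
    #|[set p : T * T | g p.2 \in V p.1]| <= #|T| * e.
  move=> gi hV; apply: (@card_fiberl T (fun a c => g c \in V a)) => a.
  by apply: leq_trans (hV a); apply: card_preim_inj.
have fr (g : T -> T) (V : T -> {set T}) : injective g -> (forall c, #|V c| <= e) ->
    #|[set p : T * T | g p.1 \in V p.2]| <= #|T| * e.
  move=> gi hV; apply: (@card_fiberr T (fun a c => g a \in V c)) => a.
  by apply: leq_trans (hV a); apply: card_preim_inj.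
have id_i : injective (@id T) by [].
have e1 (a : T) : #|[set a]| <= e by rewrite cards1.
pose Qs : seq (rel T) := [::
  fun a c => id a \in U; fun a c => next s a \in U; fun a c => next s (next s a) \in U;
  fun a c => id c \in U; fun a c => next s c \in U; fun a c => prev s c \in U;
  fun a c => id c \in [set a]; fun a c => id c \in [set next s a];
  fun a c => id c \in [set next s (next s a)];
  fun a c => next s c \in [set a]; fun a c => prev s c \in [set next s a];
  fun a c => next s a \in Kn; fun a c => id c \in Kn; fun a c => id c \in Kp;
  fun a c => next s c \in [set w | F a (prev s a) w];
  fun a c => prev s c \in [set w | F a (prev s a) w];
  fun a c => id a \in [set w | F (next s c) (next s (next s c)) w];
  fun a c => id a \in [set w | F (prev s c) (prev s (prev s c)) w];
  fun a c => id c \in [set w | F y (prev s y) w];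
  fun a c => next s a \in [set w | F x (next s x) w];
  fun a c => next s a \in Ln x; fun a c => id c \in Ln y; fun a c => id c \in Lp y].
have [||a [c [hac]]] := @avoid_bad T (switches s) Qs (#|T| * e).
- rewrite /Qs /=.
  split; first by apply: (fr id (fun=> U)).
  split; first by apply: (fr (next s) (fun=> U)).
  split; first by apply: (fr (fun v => next s (next s v)) (fun=> U)).
  split; first by apply: (fl id (fun=> U)).
  split; first by apply: (fl (next s) (fun=> U)).
  split; first by apply: (fl (prev s) (fun=> U)).
  split; first by apply: (fl id (fun a => [set a])).
  split; first by apply: (fl id (fun a => [set next s a])).
  split; first by apply: (fl id (fun a => [set next s (next s a)])).
  split; first by apply: (fl (next s) (fun a => [set a])).
  split; first by apply: (fl (prev s) (fun a => [set next s a])).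
  split; first by apply: (fr (next s) (fun=> Kn)).
  split; first by apply: (fl id (fun=> Kn)).
  split; first by apply: (fl id (fun=> Kp)).
  split; first by apply: (fl (next s) (fun a => [set w | F a (prev s a) w])).
  split; first by apply: (fl (prev s) (fun a => [set w | F a (prev s a) w])).
  split; first by apply: (fr id (fun c => [set w | F (next s c) (next s (next s c)) w])).
  split; first by apply: (fr id (fun c => [set w | F (prev s c) (prev s (prev s c)) w])).
  split; first by apply: (fl id (fun=> [set w | F y (prev s y) w])).
  split; first by apply: (fr (next s) (fun=> [set w | F x (next s x) w])).
  split; first by apply: (fr (next s) (fun=> Ln x)).
  split; first by apply: (fl id (fun=> Ln y)).
  split; first by apply: (fl id (fun=> Lp y)).
  done.
- rewrite [size _]/=.
  have T0 : 0 < #|T| by apply/card_gt0P; exists x0.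
  (* [Qs] has 23 members, for which the factor 30 in [eC] leaves room. *)
  rewrite ltnNge; apply/negP => hs.
  have : #|T| * #|T| <= C * (23 * (#|T| * e)) by rewrite (leq_trans many) // leq_mul2l hs orbT.
  have -> : C * (23 * (#|T| * e)) = #|T| * (23 * C * e) by lia.
  rewrite leq_pmul2l //; move: eC; rewrite -!mulnA; lia.
rewrite /= !inE => H; exists a, c; split=> //.
move: H; rewrite !negbK => /and5P[h1 h2 h3 h4 /and5P[h5 h6 h7 h8 /and5P[h9 h10 h11 h12 
  /and5P[h13 h14 h15 h16 /and5P[h17 h18 h19 h20 /and4P[h21 h22 h23 _]]]]]].
do !split=> //.
- by move=> hx; rewrite hx in h21.

- by move: h22; rewrite H.
by move: h23; rewrite H.
Qed.

End Choose.
Lemma improper_swap a v b w : K v w -> improper a v b = 0 -> improper a v w = 0.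
Proof. by rewrite /improper => ->; rewrite orbT /=; case: (K v a); case: (adj v a); case: (K v b). Qed.

Lemma nonK_swap a v b w : K v b -> K v w -> nonK a v w = nonK a v b.
Proof. by rewrite /nonK => -> ->. Qed.

Lemma defect_swap a v b w : adj v w -> defect a v w <= defect a v b + F v a w.
Proof. by rewrite /defect => ->; rewrite addn0; lia. Qed.

Section FixEdge.
Variables (C m e : nat).
Hypothesis rob : robust C m.
Hypotheses (e0 : 0 < e) (me : m <= e) (eC : 30 * C * e < #|T|).
Hypothesis Fe : forall v u, #|[set w | F v u w]| <= e.

(** The defect at [x] disappears with the pair [y x]. At [a], [b], [x] and [y] a new conflict can be
    avoided by fixing the vertex and its kept edge and varying the new edge. At [z] and [c] the
    vertex itself varies while the new edge leads to the fixed [x] or [y]; these two conflicts stay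
    as error terms unless the load of [x] or [y] is small. The switch keeps away from [U]. *)
Lemma fix_edge s U : valid m s -> #|U| + 4 <= e ->
  let x := head x0 s in let y := last x0 s in
  K x y -> 0 < F x y (next s x) + ~~ adj x y ->
  exists s' z z' c c',
  [/\ valid m s',
      weight s' < weight s + F z z' x + F c c' y,
      forall u, load s' u <= load s u + 12,
      [/\ z \notin U, z' \notin U, c \notin U, c' \notin U & [/\ K z z', K c c', c != z & c != z']] &
      [/\ load s x <= e -> ~~ F z z' x, load s y <= e -> ~~ F c c' y,
        (forall f, mirror f -> at_vertex f s' z = f z' z x /\ at_vertex f s' c = f y c c') &
        (forall f v, mirror f -> v \in U -> v != x -> v != y -> at_vertex f s' v = at_vertex f s v)]].
Proof.
move=> vs Ue x y Kxy def.
have [ps impr nKm] := vs.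
have us : uniq s by rewrite (perm_uniq ps) enum_uniq.
have ss : size s = #|T| by rewrite (perm_size ps) cardT.
have ms v : v \in s by rewrite (perm_mem ps) mem_enum.
(* The four added vertices keep the segments long enough; they account for the 4 in [Ue]. *)
pose U' := [set v in [:: x; y; next s x; prev s y]] :|: U.
have U'e : #|U'| <= e.
  apply: leq_trans Ue; apply: leq_trans (leq_card_setU _ _) _; rewrite addnC leq_add2l.
  by rewrite cardsE; apply: card_size.
have Kyx : K y x by rewrite K_sym.
have [a [c []]] := choose_switch vs (rob vs Kyx) e0 me U'e eC Fe.
rewrite inE -/x -/y; set z := next s a; set b := if _ then _ else _.
move=> /and5P[axz Kxz ayc Kyc /and4P[aab Kab Kaz Kcb]].
move=> [[aU zU zU'] [cU ncU pcU] [ca cz cz' nca pcz] [Kzz Kcn Kcp] [[F1 F2 F3 F4] F5 F6 F7 F8]].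
pose c' := if index c s <= index a s then next s c else prev s c.
pose b' := if index c s <= index a s then prev s b else next s b.
have inU v : v \notin U' -> [/\ v != x, v != y, v != next s x, v != prev s y & v \notin U].
  by rewrite !inE !negb_or => /andP[/and4P[-> -> -> ->] ->].
have [ax ay axx ayy aU1] := inU _ aU.
have [zx zy _ _ zU1] := inU _ zU.
have [_ _ _ _ zU1'] := inU _ zU'.
have [cx cy cxx cyy cU1] := inU _ cU.
have bU : b \notin U' by rewrite /b; case: ifP.
have c'U : c' \notin U' by rewrite /c'; case: ifP.
have [bx by_ _ _ bU1] := inU _ bU.
have [_ _ _ _ cU1'] := inU _ c'U.
have s2 : 1 < size s.
  by rewrite ss; apply/card_gt1P; exists c, a.
have az : a != z by rewrite eq_sym next_neq.
have cb : c != b.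
  rewrite /b; case: ifP => _; last by rewrite eq_sym next_neq.
  by rewrite -{1}(next_prev us c) next_neq.
have ab : a != b.
  rewrite /b; case: ifP => _; last by rewrite eq_sym.
  by apply: contraNneq cz => h; rewrite /z h next_prev.
have zb : z != b.
  rewrite /b; case: ifP => _; first by rewrite eq_sym.
  by apply: contraNneq ca => /(can_inj (prev_next us)) ->.
have xy : x != y by rewrite /x -(next_last x0 us (ltnW s2)) next_neq.
have un : uniq [:: a; z; c; b; x; y].
  by rewrite /= !inE !negb_or az ab ax ay zb zx zy cb cx cy bx by_ xy !(eq_sym _ c) ca cz.
have [s' [ps' H]] : exists s', perm_eq s' (enum T) /\ forall f, mirror f ->
  [/\ forall v, v \notin [:: a; z; c; b; x; y] -> at_vertex f s' v = at_vertex f s v,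
      at_vertex f s' a = f (prev s a) a b, at_vertex f s' b = f a b b',
      at_vertex f s' y = f (prev s y) y c &
      [/\ at_vertex f s' c = f y c c', at_vertex f s' z = f (next s z) z x & at_vertex f s' x = f z x (next s x)]].
  exact: switch_pointwise ps ax ay ayy cx cy cxx cyy ca cz un.
have Ea f : at_vertex f s a = f (prev s a) a z by [].
have Ez f : at_vertex f s z = f a z (next s z) by rewrite /at_vertex prev_next.
have Ey f : at_vertex f s y = f (prev s y) y x by rewrite /at_vertex next_last // ltnW.
have Ex f : at_vertex f s x = f y x (next s x) by rewrite /at_vertex prev_head // ltnW.
have Ec f : mirror f -> at_vertex f s c = f b c c'.
  by move=> hf; rewrite /at_vertex /c' /b; case: ifP => _ //; rewrite hf.
have Eb f : mirror f -> at_vertex f s b = f c b b'.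
  by move=> hf; rewrite /at_vertex /b' /b; case: ifP => _; rewrite ?prev_next ?next_prev // hf.
have Fc' : F b b' a = false.
  by rewrite /b' /b; case: ifP => _; apply/negbTE.
have Fab : F a (prev s a) b = false by rewrite /b; case: ifP => _; apply/negbTE.
have Kcc' : K c c' by rewrite /c'; case: ifP.
have Kzx : K z x by rewrite K_sym.
have Kcy : K c y by rewrite K_sym.
have Kba : K b a by rewrite K_sym.
have Kza : K z a by rewrite K_sym.
have Kbc : K b c by rewrite K_sym.
have azx : adj z x by rewrite adj_sym.
have acy : adj c y by rewrite adj_sym.
have aba : adj b a by rewrite adj_sym.
have mD := mirror_defect; have mI := mirror_improper; have mN := mirror_nonK.
exists s', z, (next s z), c, c'; split.
- split=> //.
    move=> v; have [h1 h2 h3 h4 [h5 h6 h7]] := H _ mI.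
    have [|] := boolP (v \in [:: a; z; c; b; x; y]); last by move=> /h1 ->.
    rewrite !inE => /orP[/eqP->|/orP[/eqP->|/orP[/eqP->|/orP[/eqP->|/orP[/eqP->|/eqP->]]]]].
    + by rewrite h2; apply: improper_swap (impr a).
    + by rewrite h6; apply: (improper_swap (b := a)) => //; rewrite mI -Ez.
    + by rewrite h5 mI; apply: (improper_swap (b := b)) => //; rewrite mI -Ec.
    + by rewrite h3 mI; apply: (improper_swap (b := c)) => //; rewrite mI -Eb.
    + by rewrite h7 mI; apply: (improper_swap (b := y)) => //; rewrite mI -Ex.
    + by rewrite h4; apply: (improper_swap (b := x)) => //; rewrite -Ey.
  apply: leq_trans nKm; apply: leq_sum => v _.
  have [h1 h2 h3 h4 [h5 h6 h7]] := H _ mN.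
  have [|] := boolP (v \in [:: a; z; c; b; x; y]); last by move=> /h1 ->.
  rewrite !inE => /orP[/eqP->|/orP[/eqP->|/orP[/eqP->|/orP[/eqP->|/orP[/eqP->|/eqP->]]]]].
  + by rewrite h2 Ea (nonK_swap _ Kaz Kab).
  + by rewrite h6 Ez (mN a) (nonK_swap _ Kza Kzx).
  + by rewrite h5 Ec // (mN y) (mN b) (nonK_swap _ Kcb Kcy).
  + by rewrite h3 Eb // (mN a) (mN c) (nonK_swap _ Kbc Kba).
  + by rewrite h7 Ex (mN z) (mN y) (nonK_swap _ Kxy Kxz).
  + by rewrite h4 Ey (nonK_swap _ Kyx Kyc).
(* Vertex by vertex: one defect is lost at [x], and nothing is gained except possibly a conflict at
   [z] or [c]. *)
- have pt v : at_vertex defect s' v + (v == x) <=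
      at_vertex defect s v + (v == z) * F z (next s z) x + (v == c) * F c c' y.
    have [h1 h2 h3 h4 [h5 h6 h7]] := H _ mD.
    have [|] := boolP (v \in [:: a; z; c; b; x; y]); last first.
      move=> hv; rewrite (h1 _ hv); move: hv; rewrite !inE !negb_or.
      by move=> /and5P[_ /negbTE-> /negbTE-> _ /andP[/negbTE-> _]]; rewrite !addn0.
    rewrite !inE => /orP[/eqP->|/orP[/eqP->|/orP[/eqP->|/orP[/eqP->|/orP[/eqP->|/eqP->]]]]].
    + rewrite h2 Ea (negbTE ax).
      by have := defect_swap (prev s a) z aab; rewrite Fab; clear; lia.
    + rewrite h6 Ez (negbTE zx) eqxx mul1n (mD a).
      by have := defect_swap (next s z) a azx; clear; lia.
    + rewrite h5 Ec // (negbTE cx) eqxx mul1n (mD y) (mD b).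
      by have := defect_swap c' b acy; clear; lia.
    + rewrite h3 Eb // (negbTE bx) (mD a) (mD c).
      by have := defect_swap b' c aba; rewrite Fc'; clear; lia.
    + rewrite h7 Ex eqxx (mD z) (mD y) /defect (F_sym x _ y) axz (negbTE F6).
      by move: def; clear; lia.
    + rewrite h4 Ey eq_sym (negbTE xy).
      by have := defect_swap (prev s y) x ayc; rewrite (negbTE F5); clear; lia.
  have := leq_sum (I := T) (index_enum T) (P := xpredT) (fun v _ => pt v).
  rewrite /weight !big_split /= -!big_distrl /=.
  have one u : \sum_v ((v == u) : nat) = 1.
    by rewrite (bigD1 u) //= eqxx big1 // => v /negbTE ->.
  by rewrite !one !mul1n addn1.
- move=> u; rewrite /load.
  (* Six vertices change a neighbour, and a clash is at most 2, whence the 12. *)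
  have pt v : at_vertex (clash u) s' v <= at_vertex (clash u) s v + (v \in [:: a; z; c; b; x; y]) * 2.
    have [h1 h2 h3 h4 [h5 h6 h7]] := H _ (@mirror_clash u).
    have [|] := boolP (v \in [:: a; z; c; b; x; y]); last by move=> /h1 ->; rewrite addn0.
    by move=> _; rewrite /at_vertex /clash; clear; lia.
  have /leq_trans := leq_sum (I := T) (index_enum T) (P := xpredT) (fun v _ => pt v); apply.
  rewrite big_split /= -big_distrl /= leq_add2l -[12]/(6 * 2) leq_mul2r.
  have := card_size [:: a; z; c; b; x; y]; rewrite -sum1_card big_mkcond /=.
  by move=> h; apply: leq_trans h; apply: leq_sum => v _; case: ifP.
- by [].
split=> //.
- by move=> /F8[h1 h2]; rewrite /c'; case: ifP.
- by move=> f hf; have [_ _ _ _ [h5 h6 _]] := H f hf.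
- move=> f v hf vU vx vy; have [h1 _ _ _ _] := H f hf; apply: h1.
  rewrite !inE (negbTE vx) (negbTE vy) !orbF; apply/negP.
  by move=> /or4P[] /eqP ev; move: vU; rewrite ev; apply/negP.
Qed.

Definition conflict a v b : nat := F v a b.
Lemma mirror_conflict : mirror conflict.
Proof. by move=> a v b; rewrite /conflict F_sym. Qed.

(** A switch breaks the pair that closes the list; a rotation, after a reversal if necessary, brings
    any prescribed pair there. *)
Lemma orient s v u : valid m s -> u = prev s v \/ u = next s v ->
  exists r, [/\ valid m r, head x0 r = v, last x0 r = u, prev r v = u &
    [/\ forall f w, mirror f -> at_vertex f r w = at_vertex f s w, weight r = weight s &
       forall w, load r w = load s w]].
Proof.
move=> vs hu.
have rotv r : perm_eq r (enum T) -> exists i, [/\ perm_eq (rot i r) (enum T),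
    head x0 (rot i r) = v & last x0 (rot i r) = prev r v].
  move=> pr; have ur : uniq r by rewrite (perm_uniq pr) enum_uniq.
  have vr : v \in r by rewrite (perm_mem pr) mem_enum.
  case: (rot_to vr) => i r' er; exists i; split; rewrite ?perm_rot // er //=.
  rewrite -(prev_rot i ur) er -[last v r']/(last x0 (v :: r')) -prev_head //.
  by rewrite -er rot_uniq.
have [ps impr nKm] := vs.
have us : uniq s by rewrite (perm_uniq ps) enum_uniq.
have [r [pr hr lr Hr]] : exists r, [/\ perm_eq r (enum T), head x0 r = v, last x0 r = u &
    forall f w, mirror f -> at_vertex f r w = at_vertex f s w].
  case: hu => ->.
    have [i [h1 h2 h3]] := rotv _ ps; exists (rot i s); split=> // f w hf.
    by rewrite /at_vertex prev_rot // next_rot.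
  have ps' : perm_eq (rev s) (enum T) by rewrite perm_rev.
  have [i [h1 h2 h3]] := rotv _ ps'; exists (rot i (rev s)).
  split=> //; first by rewrite h3 prev_rev.
  move=> f w hf; rewrite /at_vertex prev_rot ?next_rot ?rev_uniq //.
  by rewrite prev_rev // next_rev // hf.
have ur : uniq r by rewrite (perm_uniq pr) enum_uniq.
have sr : 0 < size r.
  by rewrite (perm_size pr) -cardT; apply/card_gt0P; exists x0.
exists r; split=> //; last split=> //.
- split=> // [w|]; first by rewrite Hr //; exact: mirror_improper.
  by apply: leq_trans nKm; apply: leq_sum => w _; rewrite Hr //; exact: mirror_nonK.
- by rewrite -hr prev_head.
- by apply: eq_bigr => w _; rewrite Hr //; exact: mirror_defect.
- by move=> w; apply: eq_bigr => w' _; rewrite Hr //; exact: mirror_clash.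
Qed.

(** When both ends of the broken pair have small load, the two error terms of [fix_edge] vanish. *)
Lemma fix_clean s U z z' x : valid m s -> #|U| + 4 <= e ->
  load s z <= e -> load s z' <= e -> K z z' ->
  (forall f, mirror f -> at_vertex f s z = f z' z x) -> F z z' x ->
  exists s', [/\ valid m s', weight s' < weight s, forall u, load s' u <= load s u + 12 &
    forall f v, mirror f -> v \in U -> v != z -> v != z' -> at_vertex f s' v = at_vertex f s v].
Proof.
move=> vs Ue lz lz' Kz Hz Fz.
have hu : z' = prev s z \/ z' = next s z.
  (* The hypothesis is tested on the function that detects [z'] among the two neighbours. *)
  have := Hz (fun a _ b => (a == z') || (b == z') : nat).
  rewrite /at_vertex eqxx /= => H; have : mirror (fun a _ b => (a == z') || (b == z') : nat).
    by move=> a v b /=; rewrite orbC.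
  by move=> /H; case: eqP => [-> _|_]; [left|case: eqP => // -> _; right].
have [r [vr hr lr pr [Hr wr ldr]]] := orient vs hu.
have := @fix_edge r U vr Ue; rewrite /= hr lr => /(_ Kz) [].
  have := Hr conflict z mirror_conflict; rewrite (Hz _ mirror_conflict) /at_vertex /conflict pr => ->.
  by rewrite Fz.
move=> s' [z1 [z1' [c1 [c1' [vs' ws' ls' _ [Fa Fb _ Hs']]]]]].
exists s'; split=> //.
- move: ws'; rewrite wr; have := Fa; rewrite ldr => /(_ lz) /negbTE ->.
  by have := Fb; rewrite ldr => /(_ lz') /negbTE ->; rewrite !addn0.
- by move=> u; rewrite -ldr.
- by move=> f v hf vU vz vz'; rewrite Hs' // Hr.
Qed.

(** After exchanging the sums, each [v] contributes the conflict degrees of its two pairs in the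
    order. *)
Lemma sum_load s k : perm_eq s (enum T) -> (forall v u, #|[set w | F v u w]| <= k) ->
  \sum_u load s u <= #|T| * (2 * k).
Proof.
move=> ps Fk; rewrite exchange_big /= -sum_nat_const; apply: leq_sum => v _.
rewrite /at_vertex /clash big_split /= mul2n -addnn.
have E w : \sum_u F v u w = #|[set u | F v w u]|.
  rewrite -sum1dep_card [RHS]big_mkcond /=.
  by apply: eq_bigr => u _; rewrite F_sym; case: (F _ _ _).
by rewrite !E; apply: leq_add; apply: Fk.
Qed.

Variable k : nat.
Hypothesis Fk : forall v u, #|[set w | F v u w]| <= k.
Hypotheses (e48 : 48 <= e) (ek : 8 * #|T| * k <= e * e).

(* Few vertices [v] have a large [load s v].  The first switch creates conflicts only
   at vertices [z], [c] that, like their neighbours [z'], [c'], have small load, so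
   removing [z z'] and then [c c'] creates no new conflict. *)
Lemma weight_decrease s : valid m s -> 0 < weight s ->
  exists s', valid m s' /\ weight s' < weight s.
Proof.
move=> vs; have [ps impr nKm] := vs.
rewrite lt0n sum_nat_eq0 negb_forall => /existsP[v /=]; rewrite -lt0n => dv.
(* At most one pair at [v] lies outside [K], and it is then an edge. So a non-edge at [v] is in [K],
   and a conflict at [v] can be broken at a pair in [K]. *)
have [u [hu Kvu du]] : exists u, [/\ u = prev s v \/ u = next s v, K v u &
    0 < F v (prev s v) (next s v) + ~~ adj v u].
  move: (impr v) dv; rewrite /at_vertex /improper /defect.
  case Ka: (K v (prev s v)); case Kb: (K v (next s v)); case Aa: (adj v (prev s v));
    case Ab: (adj v (next s v)) => //= _ h;
    try (by exists (prev s v); split; [left| |rewrite Aa; lia]);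
    by exists (next s v); split; [right| |rewrite Ab; lia].
have [r [vr hr lr pr [Hr wr ldr]]] := orient vs hu.
(* At most two switches precede the last one, each adding at most 12 to a load, so [z], [z'], [c],
   [c'] keep load at most [e] when it matters. *)
pose U := [set w | e - 24 < load s w].
have Ue : #|U| + 4 <= e.
  have h : #|U| * (e - 23) <= #|T| * (2 * k).
    apply: leq_trans (sum_load ps Fk); rewrite -sum_nat_const big_mkcond /=.
    by apply: leq_sum => w _; rewrite inE; case: ifP => // hw; clear -hw e48; lia.
  have h2 : #|U| * (e - 23) * 4 <= e * e by clear -h ek; lia.
  rewrite leqNgt; apply/negP => h3.
  have : (e - 3) * (e - 23) <= #|U| * (e - 23) by rewrite leq_mul2r; clear -h3 e48; lia.
  clear -h2 e48; nia.
have nU w : w \notin U -> load s w + 24 <= e by rewrite inE -leqNgt; clear -e48; lia.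
have := @fix_edge r U vr Ue; rewrite /= hr lr => /(_ Kvu) [].
  have := Hr conflict v mirror_conflict; rewrite /at_vertex /conflict pr => ->.
  exact: du.
move=> s1 [z [z' [c [c' [vs1 ws1 ls1 [zU zU' cU cU' [Kz Kc cz cz']] [_ _ Hzc _]]]]]].
rewrite wr in ws1.
have [s2 [vs2 ws2 ls2 Hc]] : exists s2, [/\ valid m s2, weight s2 < weight s + F c c' u,
    forall w, load s2 w <= load s w + 24 & forall f, mirror f -> at_vertex f s2 c = f u c c'].
  have := ws1; case Fz : (F z z' v) => ws1'; last first.
    exists s1; split=> //.
    - by rewrite addn0 in ws1'.
    - by move=> w; have := ls1 w; rewrite ldr; clear; lia.
    - by move=> f /Hzc[].
  (* [c] is protected, so that its neighbours are still known when [c c'] is broken. *)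
  have [||||s2 [vs2 ws2 ls2 Hs2]] := @fix_clean s1 [set c] z z' v vs1 _ _ _ Kz _ Fz.
  - by rewrite cards1; clear -e48; lia.
  - by have := ls1 z; rewrite ldr; have := nU _ zU; clear; lia.
  - by have := ls1 z'; rewrite ldr; have := nU _ zU'; clear; lia.
  - by move=> f /Hzc[].
  exists s2; split=> //.
  - by move: ws1' ws2; clear; lia.
  - by move=> w; have := ls2 w; have := ls1 w; rewrite ldr; clear; lia.
  - by move=> f hf; rewrite Hs2 ?set11 //; case: (Hzc f hf).
have := ws2; case Fc : (F c c' u) => ws2'; last first.
  by exists s2; split=> //; move: ws2'; rewrite addn0.
have [||||s3 [vs3 ws3 _ _]] := @fix_clean s2 set0 c c' u vs2 _ _ _ Kc _ Fc.
- by rewrite cards0; clear -e48; lia.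
- by have := ls2 c; have := nU _ cU; clear; lia.
- by have := ls2 c'; have := nU _ cU'; clear; lia.
- by move=> f hf; rewrite Hc // hf.
by exists s3; split=> //; move: ws2' ws3; clear; lia.
Qed.

Lemma weight_zero s : valid m s -> exists s', valid m s' /\ weight s' = 0.
Proof.
have [n] := ubnP (weight s); elim: n s => // n IH s hn vs.
case: (posnP (weight s)) => [w0|wp]; first by exists s.
by have [s' [vs' ws']] := weight_decrease vs wp; apply: (IH s') => //; lia.
Qed.

End FixEdge.
End Descent.

(** * Few switches force an extremal structure *)

Section Averaging.
Variable T : finType.
Implicit Types (L : {set T}) (g : T -> nat).

Lemma exists_below_average L g S : L != set0 -> \sum_v g v <= S ->
  exists2 a, a \in L & g a * #|L| <= S.
Proof.
move=> L0 gS; apply/exists_inP; apply: contraT; rewrite negb_exists_in => /forall_inP h.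
have L1 : 0 < #|L| by rewrite card_gt0.
have : \sum_(a in L) S.+1 <= \sum_(a in L) g a * #|L|.
  by apply: leq_sum => a /h; rewrite -ltnNge.
rewrite sum_nat_const -big_distrl /= mulnC leq_pmul2r // => h2.
have : \sum_(a in L) g a <= \sum_v g v by rewrite [X in X <= _]big_mkcond; apply: leq_sum => a _; case: ifP.
by move=> h3; have := leq_trans h2 (leq_trans h3 gS); rewrite ltnn.
Qed.

(** The count grows by at most one when [t] does, so every intermediate value is attained. *)
Lemma exists_prefix (s : seq T) L r : uniq s -> (forall v, v \in s) -> r <= #|L| ->
  exists t, #|[set a in L | index a s < t]| = r.
Proof.
move=> us ms; pose g t := #|[set a in L | index a s < t]|.
have gS t : g t.+1 <= (g t).+1.
  have : [set a in L | index a s < t.+1] \subset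
      [set a in L | index a s < t] :|: [set a | index a s == t].
    by apply/subsetP => a; rewrite !inE ltnS leq_eqVlt => /andP[-> /orP[->|->]]; rewrite ?orbT.
  move=> /subset_leq_card /leq_trans; apply; apply: leq_trans (leq_card_setU _ _) _.
  rewrite -addn1 leq_add2l; apply/card_le1P => a; rewrite inE => /eqP ea b.
  by rewrite !inE -ea; apply/eqP/eqP => [/(index_inj a (ms b) (ms a))|->].
have g0 : g 0 = 0 by apply: eq_card0 => a; rewrite !inE andbF.
have gn : g (size s) = #|L|.
  by apply: eq_card => a; rewrite !inE index_mem ms andbT.
rewrite -gn; elim: (size s) => [|t IH]; first by rewrite g0 leqn0 => /eqP->; exists 0.
case: (leqP r (g t)) => [/IH //|h1 h2]; exists t.+1; apply/eqP; rewrite eqn_leq h2 andbT.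
exact: leq_trans (gS t) h1.
Qed.

Lemma sum_card_fiberl (Q : rel T) : \sum_a #|[set c | Q a c]| = #|[set p : T * T | Q p.1 p.2]|.
Proof.
rewrite -sum1dep_card -(pair_big_dep xpredT Q (fun _ _ => 1)) /=.
by apply: eq_bigr => a _; rewrite sum1dep_card.
Qed.

Lemma sum_card_fiberr (Q : rel T) : \sum_c #|[set a | Q a c]| = #|[set p : T * T | Q p.1 p.2]|.
Proof.
rewrite -sum_card_fiberl.
under eq_bigr do rewrite -sum1dep_card big_mkcond.
rewrite exchange_big; apply: eq_bigr => a _ /=.
by rewrite -sum1dep_card [RHS]big_mkcond.
Qed.

End Averaging.

Lemma index_next (T : eqType) (x0 : T) (s : seq T) v : uniq s -> v \in s -> v != last x0 s ->
  index (next s v) s = (index v s).+1.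
Proof.
move=> us vs vl; have hi : index v s < size s by rewrite index_mem.
have h : (index v s).+1 < size s.
  rewrite ltn_neqAle hi andbT; apply: contraNneq vl => e.
  by rewrite -nth_last -e /= nth_index.
by rewrite -[in next _ _](nth_index x0 vs) next_nthS // index_uniq.
Qed.

Lemma index_prev (T : eqType) (x0 : T) (s : seq T) v : uniq s -> v \in s -> v != head x0 s ->
  (index (prev s v) s).+1 = index v s.
Proof.
move=> us vs vh; rewrite -(@index_next _ x0) ?mem_prev ?next_prev //.
apply: contraNneq vh => e; rewrite -(next_prev us v) e next_last //.
by case: (s) vs.
Qed.

(** * Shifted neighbourhoods in an order with few switches *)

Section Extremal.
Variables (T : finType) (x0 : T) (adj : rel T).
Hypothesis adj_sym : symmetric adj.
Let n := #|T|.
Hypothesis dirac : forall v, n <= 2 * #|[set u | adj v u]|.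

Variables (s : seq T) (h r : nat).
Hypothesis ps : perm_eq s (enum T).
Hypotheses (h5 : 5 <= h) (hr : 20 * n * h <= r * r) (rn : 8 * r <= n).
Hypothesis few : #|switches x0 adj (fun _ _ => true) s| <= h * h.

Let x := head x0 s.
Let y := last x0 s.
Let idx v := index v s.
Let N v := [set u | adj v u].
Let b a c := if idx c <= idx a then prev s c else next s c.
(** [X] is the neighbourhood of [x] shifted back along the order. [R a] consists of the vertices [b]
    whose adjacency to [a] would complete a switch when [a] is in [X], and [X1] of the [a] for which
    this rarely happens. *)
Let X := [set a | adj x (next s a)].
Let Y := N y :\: [set x; y].
Let Pa a := [set c in N y | adj a (b a c)].
Let R a := [set b a c | c in Y].
Let X1 := [set a in X | #|Pa a| <= h].
Let E a := [set k | adj a k == (k \in R a)].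

Let us : uniq s. Proof. by rewrite (perm_uniq ps) enum_uniq. Qed.
Let ms v : v \in s. Proof. by rewrite (perm_mem ps) mem_enum. Qed.

Lemma h_small : 20 * h <= r.
Proof.
have n0 : 0 < n by apply/card_gt0P; exists x0.
have r0 : 0 < r.
  rewrite lt0n; apply: contraTneq hr => ->; rewrite -ltnNge muln_gt0 muln_gt0 n0 /=.
  exact: leq_trans h5.
rewrite -(leq_pmul2l r0); apply: leq_trans hr.
rewrite mulnCA -mulnA leq_mul2l /= leq_mul2r; apply/orP; right.
by apply: leq_trans rn; rewrite leq_pmull.
Qed.

Lemma card_X : n <= 2 * #|X|.
Proof.
apply: leq_trans (dirac x) _; rewrite leq_mul2l /=.
rewrite -(card_imset _ (can_inj (next_prev us))); apply: subset_leq_card.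
apply/subsetP => _ /imsetP[v hv ->]; rewrite inE next_prev //.
by rewrite inE in hv.
Qed.

Lemma card_Y : n <= 2 * #|Y| + 4.
Proof.
have := dirac y; have := card_leqD (N y) [set x; y]; have : #|[set x; y]| <= 2 by rewrite cards2; case: eqP.
rewrite -/Y -/(N y); lia.
Qed.

Lemma b_left a c : c \in Y -> idx c <= idx a -> idx (b a c) < idx a.
Proof.
rewrite !inE negb_or => /andP[/andP[cx _] _] h1; rewrite /b h1.
by have := index_prev us (ms c) cx; rewrite /idx in h1 *; lia.
Qed.

Lemma b_right a c : c \in Y -> idx a < idx c -> idx a < idx (b a c).
Proof.
rewrite !inE negb_or => /andP[/andP[_ cy] _] h1; rewrite /b (leqNgt (idx c)) h1.
by have := index_next us (ms c) cy; rewrite /idx in h1 * => ->; lia.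
Qed.

(** On either side of [a] the map from [c] to [b] is a shift that does not cross [a], hence
    injective. Dropping [x] and [y] from [Y] prevents wrapping around. *)
Lemma card_R a : #|R a| = #|Y|.
Proof.
apply: card_in_imset => c c' cY cY' e.
case: (leqP (idx c) (idx a)) => h1; case: (leqP (idx c') (idx a)) => h2.
- by move: e; rewrite /b h1 h2 => /(can_inj (next_prev us)).
- by have := b_left cY h1; have := b_right cY' h2; rewrite e; lia.
- by have := b_right cY h1; have := b_left cY' h2; rewrite e; lia.
- by move: e; rewrite /b (leqNgt (idx c)) (leqNgt (idx c')) h1 h2 => /(can_inj (prev_next us)).
Qed.

(* Since [a] has few switches, [N a] nearly avoids [R a], hence is nearly its
   complement; [E a] collects the exceptions. *)
Lemma card_NR a : a \in X1 -> #|N a :&: R a| <= h.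
Proof.
rewrite inE => /andP[_ h1]; apply: leq_trans h1.
apply: leq_trans (leq_imset_card (b a) _); apply: subset_leq_card.
apply/subsetP => k; rewrite !inE => /andP[hk /imsetP[c cY ek]]; apply/imsetP; exists c => //.
by move: cY; rewrite !inE -ek hk => /andP[_ ->].
Qed.

Lemma card_E a : a \in X1 -> #|E a| <= 2 * h + 2.
Proof.
move=> aX; have h1 := card_NR aX.
have h2 : #|E a| <= #|N a :&: R a| + #|~: (N a :|: R a)|.
  apply: leq_trans (leq_card_setU _ _); apply: subset_leq_card; apply/subsetP => k.
  by rewrite !inE; case: (adj a k); case: (k \in R a).
have h3 := cardsC (N a :|: R a); have h4 := cardsUI (N a) (R a).
have := dirac a; have := card_Y; rewrite card_R in h4; rewrite -/(N a); rewrite -/n in h3; lia.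
Qed.

(** Each [a] in the difference takes part in more than [h] switches, out of at most [h * h]. *)
Lemma card_XX1 : #|X :\: X1| <= h.
Proof.
have h1 : #|X :\: X1| * h.+1 <= h * h.
  apply: leq_trans few; rewrite -sum_nat_const.
  pose Q a c := (a \in X) && (c \in Pa a).
  have -> : #|switches x0 adj (fun _ _ => true) s| = #|[set p : T * T | Q p.1 p.2]|.
    apply: eq_card => -[a c]; rewrite !inE /Q !inE /= !andbT -/x -/y -/(idx _) -/(idx _) -/(b a c).
    by rewrite andbA.
  rewrite -sum_card_fiberl big_mkcond /=; apply: leq_sum => a _.
  rewrite inE; case: ifP => //; rewrite !inE => /andP[h1 aX]; move: h1; rewrite aX -ltnNge => /leq_trans.
  by apply; apply: subset_leq_card; apply/subsetP => c hc; rewrite inE /Q inE aX.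
by rewrite leqNgt; apply/negP => h2; nia.
Qed.

Let fwd a := next s a \in Y.
Let bwd a := prev s a \in Y.

Lemma not_last a a' : idx a < idx a' -> a != y.
Proof.
apply: contraTneq => ->; rewrite -leqNgt /idx /y; have := index_mem a' s; rewrite ms.
by have := ms a'; case: (s) us => // v s' uv _; rewrite [last _ _]/= index_last.
Qed.

(** To the right of [a], [R a] consists of successors of members of [Y]. The gap excludes
    [a' = next s a], whose predecessor is [a] and counts as lying to the left. *)
Lemma in_R_right a a' : (idx a).+1 < idx a' -> (a' \in R a) = bwd a'.
Proof.
move=> h1; have a'x : a' != x.
  apply: contraTneq h1 => ->; rewrite /idx /x; have := ms x; case: (s) => //= v s' _.
  by rewrite eqxx.
have ip := index_prev us (ms a') a'x.
apply/imsetP/idP => [[c cY e]|hb].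
  case: (leqP (idx c) (idx a)) => h2; first by have := b_left cY h2; rewrite -e; lia.
  by rewrite /bwd e /b (leqNgt (idx c)) h2 prev_next.
exists (prev s a') => //; rewrite /b (leqNgt (idx _)).
by rewrite (_ : idx a < _) /= ?next_prev //; rewrite /idx in h1 *; lia.
Qed.

Lemma in_R_left a a' : idx a < idx a' -> (a \in R a') = fwd a.
Proof.
move=> h1; have ay := not_last h1.
have ip := index_next us (ms a) ay.
apply/imsetP/idP => [[c cY e]|hb].
  case: (leqP (idx c) (idx a')) => h2; last by have := b_right cY h2; rewrite -e; lia.
  by rewrite /fwd e /b h2 next_prev.
exists (next s a) => //; rewrite /b.
by rewrite (_ : _ <= idx a') /= ?prev_next //; rewrite /idx in h1 *; lia.
Qed.

Let inconsistent a a' := [&& a \in X1, a' \in X1, idx a < idx a' & fwd a != bwd a'].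

(* For [a] before [a'], adjacency of the two is read off from [R a] as [bwd a'] and
   from [R a'] as [fwd a], so the two booleans nearly always agree. *)
Lemma card_inconsistent : #|[set p : T * T | inconsistent p.1 p.2]| <= 5 * n * h.
Proof.
pose Q1 a a' := (a \in X1) && (a' \in E a).
pose Q2 a a' := (a' \in X1) && (a \in E a').
pose Q3 a a' := a' == next s a.
have c1 : #|[set p : T * T | Q1 p.1 p.2]| <= n * (2 * h + 2).
  apply: card_fiberl => a; rewrite /Q1; case: (boolP (a \in X1)) => aX /=.
    by apply: leq_trans (card_E aX); rewrite subset_leq_card //; apply/subsetP => k; rewrite inE.
  by rewrite (_ : [set _ | _] = set0) ?cards0 //; apply/setP => k; rewrite !inE.
have c2 : #|[set p : T * T | Q2 p.1 p.2]| <= n * (2 * h + 2).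
  apply: card_fiberr => a; rewrite /Q2; case: (boolP (a \in X1)) => aX /=.
    by apply: leq_trans (card_E aX); rewrite subset_leq_card //; apply/subsetP => k; rewrite inE.
  by rewrite (_ : [set _ | _] = set0) ?cards0 //; apply/setP => k; rewrite !inE.
have c3 : #|[set p : T * T | Q3 p.1 p.2]| <= n * 1.
  apply: card_fiberl => a; rewrite (_ : [set _ | _] = [set next s a]) ?cards1 //.
  by apply/setP => k; rewrite !inE.
have : #|[set p : T * T | inconsistent p.1 p.2]| <= n * (2 * h + 2) + n * (2 * h + 2) + n * 1.
  apply: leq_trans (leq_add (leq_add c1 c2) c3).
  apply: leq_trans (leq_add (leq_card_setU _ _) (leqnn _)).
  apply: leq_trans (leq_card_setU _ _).
  apply: subset_leq_card; apply/subsetP => -[a a']; rewrite !inE /= => /and4P[aX aX' ia ne].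
  rewrite /Q3; case: eqP => [_|/eqP na]; first by rewrite orbT.
  have ia1 : (idx a).+1 < idx a'.
    rewrite ltn_neqAle ia andbT; apply: contraNneq na => e.
    have ay := not_last ia.
    by apply/eqP/(index_inj x0 (ms a') (ms (next s a))); rewrite (index_next us (ms a) ay).
  rewrite /Q1 /Q2 aX aX' orbF; apply: contraR ne; rewrite negb_or => /andP[].
  rewrite !inE (in_R_right ia1) (in_R_left ia) (adj_sym a').
  by case: (adj a a'); case: (fwd a); case: (bwd a').
(* The total [4 * h + 5] per vertex is at most [5 * h], as [h] is at least 5. *)
move=> /leq_trans; apply; rewrite -!mulnDr -mulnA mulnCA leq_mul2l; apply/orP; right.
by move: h5; clear; lia.
Qed.

Lemma card_X1 : 2 * r < #|X1|.
Proof.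
have sub : X1 \subset X by apply/subsetP => a; rewrite inE => /andP[].
have h1 := card_XX1; have h2 := card_X; rewrite cardsDS // in h1.
by have h3 := h_small; move: h1 h2 h3 rn h5; clear; lia.
Qed.

Lemma r_gt0 : 0 < r. Proof. by have := h_small; move: h5; clear; lia. Qed.

(* Compare with one early vertex [i] and one late vertex [k]. *)
Lemma constant_shift : exists c : bool,
  #|[set a in X1 | fwd a != c]| <= 2 * r /\ #|[set a in X1 | bwd a != c]| <= 2 * r.
Proof.
(* [t1] cuts off the first [r] members of [X1], [t2] the last [r]. *)
have [t1 ht1] : exists t, #|[set a in X1 | idx a < t]| = r.
  by apply: exists_prefix => //; have := card_X1; lia.
have [t2 ht2] : exists t, #|[set a in X1 | idx a < t]| = #|X1| - r.
  by apply: exists_prefix => //; lia.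
pose L := [set a in X1 | idx a < t1]; pose Tp := [set a in X1 | t2 <= idx a].
have cT : #|Tp| = r.
  have e : Tp = X1 :\: [set a in X1 | idx a < t2].
    apply/setP => a; rewrite [in LHS]inE in_setD [a \in [set _ in _ | _]]inE.
    by case: (a \in X1); rewrite ?andbF //= andbT leqNgt.
  rewrite e cardsDS ?ht2; last by apply/subsetP => a; rewrite inE => /andP[].
  by have := card_X1; lia.
have t12 : t1 <= t2.
  rewrite leqNgt; apply/negP => lt; have : #|X1| - r <= r.
    rewrite -[X in X <= _]ht2 -[X in _ <= X]ht1; apply: subset_leq_card; apply/subsetP => a; rewrite !inE.
    by move=> /andP[-> h1] /=; exact: ltn_trans lt.
  by have := card_X1; lia.
pose S := #|[set p : T * T | inconsistent p.1 p.2]|.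
(* The 20 in [hr] is 4 times the 5 of [card_inconsistent]. *)
have hS : 4 * S <= r * r.
  apply: leq_trans hr; have := card_inconsistent; rewrite -/S; clear; lia.
have r0 := r_gt0.
have L0 : L != set0 by rewrite -card_gt0 ht1.
have [i iL hi] : exists2 i, i \in L & #|[set a' | inconsistent i a']| * #|L| <= S.
  by apply: exists_below_average => //; rewrite sum_card_fiberl.
have hi4 : 4 * #|[set a' | inconsistent i a']| <= r.
  by rewrite -(leq_pmul2r r0); apply: leq_trans hS; rewrite -mulnA leq_mul2l /= -ht1.
pose T' := Tp :\: [set a' | inconsistent i a'].
have cT' : r <= 2 * #|T'|.
  by have := card_leqD Tp [set a' | inconsistent i a']; rewrite -/T' cT; move: hi4; clear; lia.
have T0 : T' != set0 by rewrite -card_gt0; move: cT' r0; clear; lia.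
have [k kT hk] : exists2 k, k \in T' & #|[set a | inconsistent a k]| * #|T'| <= S.
  by apply: exists_below_average => //; rewrite sum_card_fiberr.
have hk2 : #|[set a | inconsistent a k]| <= r.
  rewrite -(leq_pmul2r r0); apply: leq_trans hS.
  by apply: leq_trans (leq_mul (leqnn _) cT') _; rewrite mulnCA leq_mul.
have [iX it1] : i \in X1 /\ idx i < t1 by move: iL; rewrite inE => /andP[].
move: kT; rewrite inE => /andP[nB kTp].
have [kX kt2] : k \in X1 /\ t2 <= idx k by move: kTp; rewrite inE => /andP[].
have ik : idx i < idx k := leq_trans it1 (leq_trans t12 kt2).
have e : fwd i = bwd k by move: nB; rewrite inE /inconsistent iX kX ik /= negbK => /eqP.
exists (fwd i); split.
  (* A vertex with the wrong value of [fwd] is one of the [r] late ones, or precedes [k] and is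
     inconsistent with it. *)
  apply: (@leq_trans (r + r)); last by clear; lia.
  rewrite -[X in _ <= X + _]cT; apply: leq_trans (leq_add (leqnn _) hk2).
  apply: leq_trans (leq_card_setU _ _); apply: subset_leq_card; apply/subsetP => a.
  rewrite inE => /andP[aX na]; rewrite in_setU; apply/orP.
  case: (leqP t2 (idx a)) => h2; [left|right]; rewrite inE; first by rewrite aX.
  by rewrite /inconsistent aX kX -e na andbT; exact: leq_trans h2 kt2.
apply: (@leq_trans (r + r)); last by clear; lia.
rewrite -[X in _ <= X + _]ht1.
have hi1 : #|[set a' | inconsistent i a']| <= r by move: hi4; clear; lia.
apply: leq_trans (leq_add (leqnn _) hi1).
apply: leq_trans (leq_card_setU _ _); apply: subset_leq_card; apply/subsetP => a.
rewrite inE => /andP[aX na]; rewrite in_setU; apply/orP.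
case: (ltnP (idx a) t1) => h2; [left|right]; rewrite inE; first by rewrite aX.
by rewrite /inconsistent aX iX eq_sym na andbT; exact: leq_trans it1 h2.
Qed.

(* [c = true] is the nearly bipartite case, [c = false] the case of two cliques. *)
Lemma extremal_structure : exists (X X1 : {set T}) (c : bool),
  [/\ X1 \subset X, #|X :\: X1| <= r, n <= 2 * #|X|, 2 * #|X| <= n + 12 * r &
      forall a, a \in X1 -> #|[set k | adj a k && ((k \in X) == c)]| <= 6 * r].
Proof.
have [c [ha hb]] := constant_shift.
have rh' := h_small.
have sub : X1 \subset X by apply/subsetP => a; rewrite inE => /andP[].
have main a : a \in X1 -> #|[set k in X | adj a k == c]| <= 5 * r.
  move=> aX.
  (* Outside these five sets [adj a k] is the negation of membership in [R a], which is read off as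
     [fwd k] or [bwd k], both equal to [c]. *)
  have : [set k in X | adj a k == c] \subset (X :\: X1) :|: E a :|: [set a; next s a]
      :|: [set k in X1 | fwd k != c] :|: [set k in X1 | bwd k != c].
    apply/subsetP => k; rewrite inE => /andP[kX kc]; rewrite 4!in_setU in_setD kX andbT.
    have [kX1|//] := boolP (k \in X1).
    rewrite in_set2 -!orbA orFb.
    have [|ka] := eqVneq k a; first by rewrite ?orbT.
    have [|kn] := eqVneq k (next s a); first by rewrite ?orbT.
    rewrite !orFb (in_set (fun k => _ && (fwd k != c))) (in_set (fun k => _ && (bwd k != c))) kX1 /=.
    have [alk|//] := eqVneq (fwd k) c; last by rewrite orbT.
    have [bek|//] := eqVneq (bwd k) c; last by rewrite orbT.
    rewrite orbF inE (eqP kc) eq_sym; apply/eqP.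
    have ne : idx k != idx a by apply: contraNneq ka => /(index_inj x0 (ms k) (ms a)) ->.
    move: ne; rewrite neq_ltn => /orP[lt|lt]; first by rewrite in_R_left.
    rewrite in_R_right // ltn_neqAle lt andbT; apply: contraNneq kn => e.
    have ay := not_last lt.
    by apply/eqP/(index_inj x0 (ms k) (ms (next s a))); rewrite (index_next us (ms a) ay).
  move=> /subset_leq_card /leq_trans; apply.
  have c2 : #|[set a; next s a]| <= 2 by rewrite cards2; case: (_ != _).
  apply: leq_trans (leq_card_setU _ _) _.
  apply: leq_trans (leq_add (leq_trans (leq_card_setU _ _) (leq_add (leq_trans (leq_card_setU _ _)
    (leq_add (leq_trans (leq_card_setU _ _) (leq_add card_XX1 (card_E aX))) c2)) ha)) hb) _.
  by move: rh' h5; clear; lia.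
have cNR a : a \in X1 -> 2 * #|N a| <= n + 4 + 2 * h.
  move=> aX; have := card_NR aX; have := cardsUI (N a) (R a); rewrite card_R.
  by have := card_Y; have := max_card (N a :|: R a); rewrite -/n; clear; lia.
have split_false a : [set k in X | adj a k == false] = X :\: N a.
  by apply/setP => k; rewrite in_setD inE; rewrite [k \in N a]inE; case: (adj a k); rewrite ?andbT ?andbF.
have split_true a : [set k in X | adj a k == true] = N a :&: X.
  by apply/setP => k; rewrite in_setI inE; rewrite [k \in N a]inE; case: (adj a k); rewrite ?andbT ?andbF.
exists X, X1, c; split=> //.
- by have := card_XX1; move: rh' h5; clear; lia.
- exact: card_X.
(* [N a] nearly avoids [X] if [c] is true; otherwise it nearly contains [X], while [cNR] bounds its
   size. Either way [X] cannot be much larger than half. *)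
- have [a aX] : exists a, a \in X1 by apply/card_gt0P; have := card_X1; clear; lia.
  have := main a aX; have dN := dirac a; rewrite -/(N a) in dN.
  case: (c).
    rewrite split_true; have := cardsUI (N a) X; have := max_card (N a :|: X); rewrite -/n.
    by move: dN; clear; lia.
  rewrite split_false; have := card_leqD X (N a); have := cNR a aX.
  by move: rh' h5; clear; lia.
- move=> a aX; have := main a aX; case: (c).
    rewrite split_true => h1; apply: leq_trans (leq_trans _ h1) _; last by clear; lia.
    by apply: subset_leq_card; apply/subsetP => k; rewrite in_setI !in_set eqb_id.
  rewrite split_false => h1; have h2 := cNR a aX; have h3 := card_X.
  have -> : [set k | adj a k && ((k \in X) == false)] = N a :\: X.
    by apply/setP => k; rewrite in_setD in_set [k \in N a]inE eqbF_neg andbC.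
  have := cardsID X (N a); have := cardsID (N a) X; rewrite (setIC X).
  by move: h1 h2 h3 rh' h5; clear; lia.
Qed.

End Extremal.

(** * Graphs with an extremal structure *)

Section RobustWalk.
Variables (T : finType) (x0 : T) (adj K : rel T).
Hypothesis K_sym : symmetric K.
Hypothesis K_walk3 : forall a b c d, K a b -> K b c -> K c d -> K a d.
Variables (W : {set T}) (e m : nat).
Hypothesis degK : forall v, #|T| <= 25 * #|[set u | adj v u && K v u]|.
Hypotheses (We : #|W| <= e) (me : m <= e) (en : 100 * 2 * e <= #|T|).
Hypothesis miss : forall v, v \notin W -> #|[set u | K v u && ~~ adj v u]| <= e.

(** The walks [a z x y] and [a y c b] in [K] make [b] a [K]-neighbour of [a], and outside [W] nearly
    all of these are adjacent to [a]. Adjacency of [a] and [b] thus comes for free. There are at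
    least [#|T| / 50] choices for [a] and then for [c], whence 2500. *)
Lemma robust_walk : robust x0 adj K 2500 m.
Proof.
move=> s vs Kyx; have [ps impr nKm] := vs.
set y := last x0 s in Kyx *; set x := head x0 s in Kyx *.
have us : uniq s by rewrite (perm_uniq ps) enum_uniq.
have ni : injective (next s) := can_inj (prev_next us).
have pi : injective (prev s) := can_inj (next_prev us).
pose Kn := [set v | ~~ K v (next s v)]; pose Kp := [set v | ~~ K v (prev s v)].
have Kne : #|Kn| <= e.
  apply: leq_trans (leq_trans nKm me); apply: card_leq_sum => v.
  by rewrite inE /at_vertex /nonK => ->; rewrite addn1.
have Kpe : #|Kp| <= e.
  apply: leq_trans (leq_trans nKm me); apply: card_leq_sum => v.
  by rewrite inE /at_vertex /nonK => ->.
pose A0 := [set a | adj x (next s a) && K x (next s a)] :\: Kn :\: W.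
pose M a := [set u | K a u && ~~ adj a u].
pose C0 a := [set c | adj y c && K y c] :\: Kn :\: Kp :\: next s @^-1: M a :\: prev s @^-1: M a.
have hA : #|T| <= 50 * #|A0|.
  have h0 := degK x; rewrite -(card_preimset _ ni) in h0.
  have -> : A0 = next s @^-1: [set u | adj x u && K x u] :\: Kn :\: W.
    by apply/setP => a; rewrite !inE.
  set P0 := _ @^-1: _ in h0 *.
  by have := card_leqD P0 Kn; have := card_leqD (P0 :\: Kn) W; move: h0 Kne We en; clear; lia.
have hC a : a \in A0 -> #|T| <= 50 * #|C0 a|.
  rewrite inE => /andP[aW _]; have h0 := degK y; have Me := miss aW.
  have := card_leqD [set u | adj y u && K y u] Kn.
  have := card_leqD ([set u | adj y u && K y u] :\: Kn) Kp.
  have := card_leqD ([set u | adj y u && K y u] :\: Kn :\: Kp) (next s @^-1: M a).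
  have := card_leqD ([set u | adj y u && K y u] :\: Kn :\: Kp :\: next s @^-1: M a) (prev s @^-1: M a).
  rewrite !card_preimset // -/(C0 a) -/(M a).
  by move: h0 Kne Kpe Me en; rewrite -/(M a); clear; lia.
pose Q a c := (a, c) \in switches x0 adj K s.
have -> : #|switches x0 adj K s| = #|[set p : T * T | Q p.1 p.2]|.
  by apply: eq_card => -[a c]; rewrite [RHS]inE.
have h : \sum_(a in A0) #|T| <= \sum_a 50 * #|[set c | Q a c]|.
  rewrite big_mkcond; apply: leq_sum => a _; case: ifP => // aA.
  apply: leq_trans (hC a aA) _; rewrite leq_mul2l; apply/orP; right.
  apply: subset_leq_card; apply/subsetP => c cC; move: aA cC.
  rewrite [c \in [set _ | _]]inE /Q !inE /= ?negbK -/x -/y => /and4P[aW Kaz -> Kxz].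
  move=> /and5P[pc nc Kcp Kcn /andP[-> Kyc]]; rewrite Kxz Kyc Kaz /=.
  set b := if _ then _ else _.
  have Kcb : K c b by rewrite /b; case: ifP.
  have Kab : K a b.
    apply: (K_walk3 _ Kyc Kcb).
    by apply: (K_walk3 Kaz); [rewrite K_sym; exact: Kxz | rewrite K_sym].
  rewrite Kab Kcb !andbT /=.
  by move: pc nc Kab; rewrite /b; case: ifP => _ pc nc Kab; apply: contraT => nadj;
     [move: pc | move: nc]; rewrite Kab nadj.
rewrite sum_nat_const -big_distrr /= sum_card_fiberl in h.
rewrite -[2500]/(50 * 50) -mulnA; apply: leq_trans (leq_mul (leqnn 50) h).
by rewrite mulnA leq_mul2r hA orbT.
Qed.

End RobustWalk.

(** Same side for [c = false], opposite sides for [c = true]; both relations are closed under walks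
    of length three. *)
Definition side (T : finType) (A : {set T}) (c : bool) : rel T :=
  fun u v => ((u \in A) == (v \in A)) (+) c.

(** * Most vertices see nearly all of their expected side *)

Section Typical.
Variables (T : finType) (adj : rel T).
Hypothesis adj_sym : symmetric adj.
Let n := #|T|.
Hypothesis dirac : forall v, n <= 2 * #|[set u | adj v u]|.
Variables (X X1 : {set T}) (c : bool) (r e : nat).
Hypotheses (X1X : X1 \subset X) (XX1 : #|X :\: X1| <= r).
Hypotheses (nX : n <= 2 * #|X|) (Xn : 2 * #|X| <= n + 12 * r).
Hypothesis few : forall a, a \in X1 -> #|[set k | adj a k && ((k \in X) == c)]| <= 6 * r.
Hypotheses (e0 : 0 < e) (re : 12 * r <= e) (rne : 48 * (r * n) <= e * e).

Let N v := [set u | adj v u].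
Let S b := [set k | (k \in X) == b].
Let missing v := [set u | side X c v u && ~~ adj v u].
Let W := [set v | e < #|missing v|].

Lemma card_S b : 2 * #|S b| <= n + 12 * r /\ n <= 2 * #|S b| + 12 * r.
Proof.
have hX : S true = X by apply/setP => k; rewrite inE eqb_id.
have hC : S false = ~: X by apply/setP => k; rewrite !inE eqbF_neg.
by have := cardsC X; case: b; rewrite ?hX ?hC -/n; move: nX Xn; clear; lia.
Qed.

(** The degree is at least [n / 2], at most [6 * r] of it is outside the expected side, and that
    side has at most [n / 2 + 6 * r] vertices. *)
Lemma missing_core a : a \in X1 -> #|missing a| <= 12 * r.
Proof.
move=> aX1; have aX := subsetP X1X _ aX1.
have e1 : missing a = S (~~ c) :\: N a.
  by apply/setP => k; rewrite !inE /side aX andbC; case: (k \in X); case: c.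
have e2 : [set k | adj a k && ((k \in X) == c)] = N a :\: S (~~ c).
  by apply/setP => k; rewrite !inE andbC; case: (k \in X); case: c.
have h := few aX1; rewrite e2 in h; rewrite e1.
have := cardsID (N a) (S (~~ c)); have := cardsID (S (~~ c)) (N a); rewrite (setIC (N a)).
have := dirac a; have := card_S (~~ c); rewrite -/(N a).
by move: h; clear; lia.
Qed.

Let g u := #|[set k in X1 | adj u k != c]|.

(** For [c = true] missing and wrong adjacencies coincide up to [X :\: X1]. For [c = false] the
    complement of [X] has at most [n / 2] vertices, so every neighbour missed there is made up for
    by one in [X]. *)
Lemma missing_outer u : u \notin X -> #|missing u| <= g u + r.
Proof.
move=> /negbTE uX.
have [cT|cF] : c = true \/ c = false by case: c; [left|right].
  apply: leq_trans (leq_add (leqnn _) XX1); apply: leq_trans (leq_card_setU _ _).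
  apply: subset_leq_card; apply/subsetP => k; rewrite !inE /side uX cT.
  by case: (k \in X1); case: (k \in X); case: (adj u k).
have e1 : missing u = S false :\: N u.
  by apply/setP => k; rewrite !inE /side uX cF andbC; case: (k \in X).
have h1 : #|N u :\: S false| <= g u + r.
  apply: leq_trans (leq_add (leqnn _) XX1); apply: leq_trans (leq_card_setU _ _).
  apply: subset_leq_card; apply/subsetP => k; rewrite !inE cF.
  by case: (k \in X1); case: (k \in X); case: (adj u k).
have hC : S false = ~: X by apply/setP => k; rewrite !inE eqbF_neg.
have := cardsID (N u) (S false); have := cardsID (S false) (N u); rewrite (setIC (N u)).
have := dirac u; have := cardsC X; rewrite -hC -e1 -/n -/(N u).
by move: h1 nX; clear; lia.
Qed.

(** Summed over the [u] outside [X], [g] counts wrong pairs, of which each member of [X1] has at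
    most [12 * r]. By [rne] the total is at most [e * e / 4], so few [u] have a large [g u]. *)
Lemma typical : #|W| <= e /\ forall v, v \notin W -> #|missing v| <= e.
Proof.
split; last by move=> v; rewrite inE -leqNgt.
pose G := [set u | (u \notin X) && (e - r < g u)].
have sub : W \subset (X :\: X1) :|: G.
  apply/subsetP => v; rewrite !inE => hv.
  have [vX1|_] := boolP (v \in X1).
    by have := missing_core vX1; move: hv re; clear; lia.
  have [//|vX] := boolP (v \in X).
  by have := missing_outer vX; move: hv re; rewrite /=; clear; lia.
have sumg : \sum_(u | u \notin X) g u <= n * (12 * r).
  have -> : \sum_(u | u \notin X) g u = \sum_(k in X1) #|[set u | (u \notin X) && (adj u k != c)]|.
    under eq_bigr do rewrite /g -sum1dep_card big_mkcondr.
    rewrite exchange_big /=; apply: eq_bigr => k _.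
    by rewrite -sum1dep_card [RHS]big_mkcondr.
  apply: (@leq_trans (\sum_(k in X1) 12 * r)); last by rewrite sum_nat_const leq_mul2r max_card orbT.
  apply: leq_sum => k kX1; have kX := subsetP X1X _ kX1.
  have [cT|cF] : c = true \/ c = false by case: c; [left|right].
    apply: leq_trans (missing_core kX1); apply: subset_leq_card; apply/subsetP => u.
    by rewrite !inE /side kX cT (adj_sym k); case: (u \in X); case: (adj u k).
  apply: leq_trans (leq_trans (few kX1) _); last by clear; lia.
  apply: subset_leq_card; apply/subsetP => u.
  by rewrite !inE cF (adj_sym k); case: (u \in X); case: (adj u k).
have hG : #|G| * (e - r) <= n * (12 * r).
  apply: leq_trans sumg; rewrite -sum_nat_const big_mkcond [X in _ <= X]big_mkcond /=.
  by apply: leq_sum => u _; rewrite inE; case: (u \in X) => //=; case: ifP => // /ltnW.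
have h := leq_trans (subset_leq_card sub) (leq_card_setU _ _).
have h2 : 2 * #|G| <= e.
  rewrite leqNgt; apply/negP => h3.
  have h4 : 11 * e <= 12 * (e - r) by move: re; clear; lia.
  have := leq_mul h3 h4; move: hG rne e0; clear; move: (e - r) (#|G|) => k q; nia.
by move: h h2 XX1 re; clear; lia.
Qed.

End Typical.

Definition symdiff (T : finType) (A B : {set T}) := (A :\: B) :|: (B :\: A).

Lemma in_symdiff (T : finType) (A B : {set T}) v : (v \in symdiff A B) = ((v \in A) != (v \in B)).
Proof. by rewrite !inE; case: (v \in A); case: (v \in B). Qed.

Lemma side_sym (T : finType) (A : {set T}) c : symmetric (side A c).
Proof. by move=> u v; rewrite /side eq_sym. Qed.

Lemma side_walk3 (T : finType) (A : {set T}) c u v w z :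
  side A c u v -> side A c v w -> side A c w z -> side A c u z.
Proof.
by rewrite /side; case: (u \in A); case: (v \in A); case: (w \in A); case: (z \in A); case: c.
Qed.

(* Distances to the sides are measured in the fixed set [X], so that [fits] is
   a condition on each vertex separately while [A] varies. *)
Definition fits (T : finType) (adj : rel T) (X : {set T}) c (A : {set T}) :=
  forall v, #|T| <= 20 * #|[set k | adj v k && (((v \in A) == (k \in X)) (+) c)]|.

(** * Placing the atypical vertices *)

Section Fit.
Variables (T : finType) (x0 : T) (adj : rel T).
Let n := #|T|.
Variables (X W : {set T}) (c : bool) (e : nat).
Hypothesis typ : forall v, v \notin W -> #|[set u | side X c v u && ~~ adj v u]| <= e.

(** Only vertices of [W] may move: such a vertex joins [A] if a fifth of all vertices are neighbours
    on the side expected there; otherwise more than [n / 2 - n / 5] neighbours are on the other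
    side. *)
Lemma fits_exists :
  (forall v, n <= 2 * #|[set u | adj v u]|) ->
  n <= 2 * #|X| + e -> 2 * #|X| <= n + e -> 10 * e <= n ->
  exists A, fits adj X c A /\ symdiff A X \subset W.
Proof.
move=> dirac nX Xn en.
pose A := [set v | if v \in W then n <= 5 * #|[set k | adj v k && ((k \in X) (+) c)]| else v \in X].
exists A; split; last first.
  by apply/subsetP => v; rewrite in_symdiff [v \in A]inE; case: (v \in W) => //; rewrite eqxx.
move=> v; rewrite -/n [v \in A]inE; have [vW|vW] := boolP (v \in W).
  set M := [set k | adj v k && ((k \in X) (+) c)]; case: (leqP n (5 * #|M|)) => h.
    rewrite (_ : [set k | _] = M); first by apply: leq_trans h _; rewrite leq_mul2r orbT.
    by apply/setP => k; rewrite !inE.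
  have -> : [set k | adj v k && ((false == (k \in X)) (+) c)] = [set u | adj v u] :\: M.
    by apply/setP => k; rewrite !inE; case: (adj v k); case: (k \in X); case: c.
  by have := card_leqD [set u | adj v u] M; have := dirac v; move: h; clear; lia.
have h := typ vW; set M := [set u | side X c v u && ~~ adj v u] in h.
have -> : [set k | adj v k && (((v \in X) == (k \in X)) (+) c)] = [set k | side X c v k] :\: M.
  by apply/setP => k; rewrite !inE /side; case: (adj v k); case: (_ (+) _).
have := card_leqD [set k | side X c v k] M.
have : [set k | side X c v k] = X \/ [set k | side X c v k] = ~: X.
  case E: ((v \in X) (+) c); [left|right]; apply/setP => k; rewrite !inE /side; move: E;
    by case: (v \in X); case: (k \in X); case: c.
by have := cardsC X; rewrite -/n; move: nX Xn en h => nX Xn en h hc [] ->; move: hc nX Xn en h; clear; lia.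
Qed.

(** Passing from [X] to [A] costs at most [d] neighbours, which lowers the fraction 1/20 of [fits]
    to no less than 1/25. *)
Lemma fits_robust A d m : #|W| <= e -> fits adj X c A -> #|symdiff A X| <= d ->
  m <= e + d -> 200 * (e + d) <= n -> robust x0 adj (side A c) 2500 m.
Proof.
move=> We fA hd md nd.
apply: (@robust_walk T x0 adj (side A c) _ _ (W :|: symdiff A X) (e + d) m) => //.
- exact: side_sym.
- by move=> a1 a2 a3 a4; apply: side_walk3.
- move=> v; have h := fA v.
  set M := [set k | adj v k && (((v \in A) == (k \in X)) (+) c)] in h.
  have sub : M :\: symdiff A X \subset [set u | adj v u && side A c v u].
    apply/subsetP => k; rewrite in_setD in_symdiff !inE negbK /side => /andP[/eqP -> ->].
    by [].
  have := subset_leq_card sub; have := card_leqD M (symdiff A X).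
  by move: h hd nd; rewrite -/n; clear; lia.
- by apply: leq_trans (leq_card_setU _ _) _; apply: leq_add.
- move=> v; rewrite in_setU negb_or in_symdiff negbK => /andP[vW /eqP vA].
  apply: leq_trans (leq_add (typ vW) hd); apply: leq_trans (leq_card_setU _ _).
  apply: subset_leq_card; apply/subsetP => k; rewrite in_setU in_symdiff !inE /side vA.
  by case: (k \in A); case: (k \in X); case: (v \in X); case: c; case: (adj v k).
Qed.

End Fit.

(** * Starting orders in the two extremal cases *)

Section Orders.
Variables (T : finType) (x0 : T) (adj : rel T).
Hypothesis adj_sym : symmetric adj.
Implicit Types (f : T -> T -> T -> nat).

Lemma tri_cons f a b c l : tri x0 f (a :: b :: c :: l) = f a b c + tri x0 f (b :: c :: l).
Proof. by rewrite /tri /= !subSS !subn0 big_ord_recl. Qed.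

Lemma tri_homogeneous f (B : {pred T}) l : (forall a v b, a \in B -> v \in B -> b \in B -> f a v b = 0) ->
  {subset l <= B} -> tri x0 f l = 0.
Proof.
move=> hf hl; apply: big1 => i _; have hi := ltn_ord i.
by apply: hf; apply: hl; apply: mem_nth; lia.
Qed.

Lemma valid_of_sums K s m : perm_eq s (enum T) ->
  \sum_v at_vertex (improper adj K) s v = 0 -> \sum_v at_vertex (nonK K) s v <= m -> valid adj K m s.
Proof.
by move=> ps /eqP; rewrite sum_nat_eq0 => /forallP h hm; split=> // v; exact/eqP/h.
Qed.

Section Bipartite.
Variable A : {set T}.
Let K := side A true.

(** A block is a vertex outside [A], one in [A] and, optionally, a matching partner of the latter.
    Concatenated blocks alternate between the sides except at the matching edges. *)
Let flat (p : T * T * option T) := p.1.1 :: p.1.2 :: seq_of_opt p.2.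
Let good (p : T * T * option T) :=
  [&& p.1.1 \notin A, p.1.2 \in A & if p.2 is Some a' then (a' \in A) && adj p.1.2 a' else true].

Lemma perm_flat l : perm_eq (flatten (map flat l))
  ([seq p.1.1 | p <- l] ++ [seq p.1.2 | p <- l] ++ flatten [seq seq_of_opt p.2 | p <- l]).
Proof.
elim: l => //= -[[b a] o] l /permP IH; apply/permP => P.
have := IH P; rewrite !count_cat /= !count_cat /= count_cat; case: o => [a'|] /=; lia.
Qed.

(** Each matching edge lies in two triples, and all others alternate. [w] will be 0 for [improper]
    and 1 for [nonK]; the final pair stands for the two entries repeated to close the cycle. *)
Lemma tri_blocks f w l b' a' :
  (forall b1 a b2, b1 \notin A -> a \in A -> b2 \notin A -> f b1 a b2 = 0) ->
  (forall a1 b a2, a1 \in A -> b \notin A -> a2 \in A -> f a1 b a2 = 0) ->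
  (forall b a1 a2, b \notin A -> a1 \in A -> a2 \in A -> adj a1 a2 -> f b a1 a2 <= w) ->
  (forall b a1 a2, b \notin A -> a1 \in A -> a2 \in A -> adj a1 a2 -> f a1 a2 b <= w) ->
  all good l -> b' \notin A -> a' \in A ->
  tri x0 f (flatten (map flat l) ++ [:: b'; a']) <= 2 * w * size (flatten [seq seq_of_opt p.2 | p <- l]).
Proof.
move=> f1 f2 f3 f4 hl hb ha; elim: l hl => [|[[b a] o] l IH] /=.
  by rewrite tri2.
move=> /andP[/and3P[/= bA aA oA] /[dup] hl /IH {}IH].
have [b2 [a2 [q [hb2 ha2 eq]]]] : exists b2 a2 q, [/\ b2 \notin A, a2 \in A &
    flatten (map flat l) ++ [:: b'; a'] = b2 :: a2 :: q].
  case: l hl {IH} => [|[[b2 a2] o2] l] /=; first by exists b', a', [::].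
  by move=> /andP[/and3P[/= h1 h2 _] _]; exists b2, a2,
    ((seq_of_opt o2 ++ flatten (map flat l)) ++ [:: b'; a']).
case: o oA => [c /andP[cA ac]|_] /=; rewrite eq in IH *.
  rewrite !tri_cons (f2 c) //; have := f3 b a c bA aA cA ac; have := f4 b2 a c hb2 aA cA ac.
  rewrite add0n addnA => h1 h2; apply: leq_trans (leq_add (leq_add h2 h1) IH) _; rewrite mulnS; clear; lia.
by rewrite !tri_cons (f1 b) // (f2 a).
Qed.

Lemma bipartite_order (M : seq (T * T)) :
  #|A| = #|~: A| + size M -> 0 < #|~: A| ->
  uniq (unzip1 M ++ unzip2 M) -> all (fun p => [&& p.1 \in A, p.2 \in A & adj p.1 p.2]) M ->
  exists s, valid adj K (2 * size M) s.
Proof.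
move=> cA A0 uM aM.
pose V := unzip1 M ++ unzip2 M.
have VA : [set v in V] \subset A.
  apply/subsetP => v; rewrite inE mem_cat => /orP[] /mapP[p pM ->];
    by have /and3P[] := allP aM p pM.
pose rest := enum (A :\: [set v in V]).
(* There are as many blocks as vertices outside [A], because [M] absorbs exactly the surplus of
   [A]. *)
pose bl := [seq (p.1, Some p.2) | p <- M] ++ [seq (a, None) | a <- rest].
pose Bs := enum (~: A).
have sV : #|[set v in V]| = 2 * size M.
  by rewrite cardsE (card_uniqP uM) size_cat !size_map mul2n addnn.
have sbl : size bl = size Bs.
  rewrite size_cat !size_map -!cardE cardsDS // sV cA.
  have := subset_leq_card VA; rewrite sV cA; clear; lia.
pose l := [seq (q.1, q.2.1, q.2.2) | q <- zip Bs bl].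
have e1 : [seq p.1.1 | p <- l] = Bs.
  by rewrite -map_comp (eq_map (g := fst)) // -/(unzip1 _) unzip1_zip // sbl.
have e23 (S : Type) (g : T * option T -> S) : [seq g (p.1.2, p.2) | p <- l] = map g bl.
  rewrite -map_comp (eq_map (g := g \o snd)); last by case=> ? [].
  by rewrite map_comp -/(unzip2 _) unzip2_zip // sbl.
have e2 : [seq p.1.2 | p <- l] = unzip1 M ++ rest.
  rewrite (e23 _ fst) map_cat -!map_comp (eq_map (g := fst)) // (eq_map (f := fst \o _) (g := id)) //.
  by rewrite map_id.
have e3 : flatten [seq seq_of_opt p.2 | p <- l] = unzip2 M.
  rewrite (e23 _ (fun p => seq_of_opt p.2)) map_cat -!map_comp flatten_cat.
  rewrite (_ : flatten [seq _ | _ <- rest] = [::]) ?cats0; last by elim: (rest).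
  by rewrite -[RHS]flatten_map1.
have ps : perm_eq (flatten (map flat l)) (enum T).
  apply: perm_trans (perm_flat l) _; rewrite e1 e2 e3.
  have pe : perm_eq (Bs ++ (unzip1 M ++ rest) ++ unzip2 M) (V ++ rest ++ Bs).
    by apply/permP => P; rewrite !count_cat; lia.
  apply: perm_trans pe _; apply: uniq_perm; rewrite ?enum_uniq //.
    rewrite (cat_uniq V) uM (cat_uniq rest) !enum_uniq /= andbT; apply/andP; split.
      rewrite has_cat negb_or; apply/andP; split; apply/hasPn => v; rewrite mem_enum.
        by rewrite !inE => /andP[].
      by rewrite inE; apply: contra => hv; apply: (subsetP VA); rewrite inE.
    by apply/hasPn => v; rewrite !mem_enum !inE; case: (v \in A); rewrite ?andbF.
  move=> v; rewrite !mem_cat !mem_enum !inE mem_cat.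
  by case: (v \in A); case: (v \in unzip1 M); case: (v \in unzip2 M).
have gl : all good l.
  apply/allP => _ /mapP[q qz ->]; have q1 : q.1 \in Bs.
    by rewrite -(unzip1_zip (s := Bs) (t := bl)) ?sbl // map_f.
  have : q.2 \in bl by rewrite -(unzip2_zip (s := Bs) (t := bl)) ?sbl // map_f.
  rewrite mem_enum inE in q1; rewrite /good /= q1 mem_cat => /orP[] /mapP[p pM ->] /=.
    by have /and3P[-> -> ->] := allP aM p pM.
  by move: pM; rewrite mem_enum inE => /andP[_ ->].
have us : uniq (flatten (map flat l)) by rewrite (perm_uniq ps) enum_uniq.
have sl : 0 < size l by rewrite size_map size_zip sbl minnn -cardE.
have sum_le f w : (forall b1 a b2, b1 \notin A -> a \in A -> b2 \notin A -> f b1 a b2 = 0) ->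
  (forall a1 b a2, a1 \in A -> b \notin A -> a2 \in A -> f a1 b a2 = 0) ->
  (forall b a1 a2, b \notin A -> a1 \in A -> a2 \in A -> adj a1 a2 -> f b a1 a2 <= w) ->
  (forall b a1 a2, b \notin A -> a1 \in A -> a2 \in A -> adj a1 a2 -> f a1 a2 b <= w) ->
  \sum_v at_vertex f (flatten (map flat l)) v <= 2 * w * size M.
  move=> f1 f2 f3 f4; rewrite sum_at_vertexE // (at_vertex_sumE x0) //; last first.
    by case: (l) sl => //= p l' _; rewrite ltnS.
  have [b [a [-> bA aA]]] : exists b a, [/\ take 2 (flatten (map flat l)) = [:: b; a], b \notin A & a \in A].
    case: (l) sl gl => //= p l' _ /andP[/and3P[h1 h2 _] _].
    by exists p.1.1, p.1.2; rewrite take0.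
  have := tri_blocks f1 f2 f3 f4 gl bA aA.
  by rewrite e3 size_map.
have Kab a b : a \in A -> b \notin A -> K a b by move=> ha /negbTE hb; rewrite /K /side ha hb.
have Kba a b : a \in A -> b \notin A -> K b a by move=> ha /negbTE hb; rewrite /K /side ha hb.
exists (flatten (map flat l)); apply: valid_of_sums => //.
  apply/eqP; rewrite -leqn0 -[0]/(2 * 0 * size M); apply: sum_le.
  - by move=> b1 a b2 h1 h2 h3; rewrite /improper !Kab.
  - by move=> a1 b a2 h1 h2 h3; rewrite /improper !Kba.
  - by move=> b a1 a2 h1 h2 h3 h4; rewrite /improper Kab // h4 orbT.
  - by move=> b a1 a2 h1 h2 h3 h4; rewrite /improper (Kab a2 b) // (adj_sym a2) h4 !orbT.
rewrite -[2]/(2 * 1); apply: sum_le.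
- by move=> b1 a b2 h1 h2 h3; rewrite /nonK !Kab.
- by move=> a1 b a2 h1 h2 h3; rewrite /nonK !Kba.
- by move=> b a1 a2 h1 h2 h3 h4; rewrite /nonK Kab //; case: (K _ _).
- by move=> b a1 a2 h1 h2 h3 h4; rewrite /nonK (Kab a2 b) //; case: (K _ _).
Qed.

End Bipartite.

(** List [A] from [a1] to [a2], then the complement from [b2] to [b1]. Only [a2 b2] and [b1 a1] lie
    outside [K], each counted at both ends. *)
Lemma two_cliques_order (A : {set T}) a1 a2 b1 b2 :
  a1 \in A -> a2 \in A -> a1 != a2 -> b1 \notin A -> b2 \notin A -> b1 != b2 ->
  adj a1 b1 -> adj a2 b2 -> exists s, valid adj (side A false) 4 s.
Proof.
move=> a1A a2A a12 b1A b2A b12 ab1 ab2.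
set K := side A false.
have KA a b : a \in A -> b \in A -> K a b by move=> ha hb; rewrite /K /side ha hb.
have KB a b : a \notin A -> b \notin A -> K a b.
  by move=> /negbTE ha /negbTE hb; rewrite /K /side ha hb.
pose u := a1 :: rcons (enum (A :\: [set a1; a2])) a2.
pose v := b2 :: rcons (enum (~: A :\: [set b1; b2])) b1.
have uA : {subset u <= A}.
  move=> w; rewrite inE mem_rcons inE mem_enum in_setD.
  by move=> /or3P[/eqP->|/eqP->|/andP[]].
have vA : {subset v <= [predC A]}.
  move=> w; rewrite !inE mem_rcons inE mem_enum in_setD in_setC.
  by move=> /or3P[/eqP->|/eqP->|/andP[]].
have su : 1 < size u by rewrite /= size_rcons.
have sv : 1 < size v by rewrite /= size_rcons.
have ps : perm_eq (u ++ v) (enum T).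
  apply: uniq_perm; rewrite ?enum_uniq //.
    rewrite cat_uniq; apply/and3P; split.
    - rewrite /= mem_rcons inE negb_or a12 mem_enum !inE eqxx /= rcons_uniq enum_uniq.
      by rewrite mem_enum !inE eqxx orbT.
    - by apply/hasPn => w /vA; apply: contra => /uA.
    - rewrite /= mem_rcons inE negb_or (eq_sym b2) b12 mem_enum !inE eqxx orbT /= rcons_uniq.
      by rewrite enum_uniq mem_enum !inE eqxx.
  move=> w; rewrite mem_cat !inE !mem_rcons !inE !mem_enum !inE.
  by case: (w == a1); case: (w == a2); case: (w == b1); case: (w == b2); case: (w \in A).
have us : uniq (u ++ v) by rewrite (perm_uniq ps) enum_uniq.
have [u0 u2 v0 v2 uv] : [/\ 0 < size u, (size u).-2 < size u, 0 < size v, (size v).-2 < size v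
    & 1 < size u + size v].
  by move: su sv; move: (size u) (size v) => p q; clear; split; lia.
have mu i : i < size u -> nth x0 u i \in A by move=> hi; apply/uA/mem_nth.
have mv i : i < size v -> nth x0 v i \notin A by move=> hi; apply/vA/mem_nth.
have lu : nth x0 u (size u).-1 = a2 by rewrite nth_last /= last_rcons.
have lv : nth x0 v (size v).-1 = b1 by rewrite nth_last /= last_rcons.
have sumE f : (forall a w b, a \in A -> w \in A -> b \in A -> f a w b = 0) ->
  (forall a w b, a \notin A -> w \notin A -> b \notin A -> f a w b = 0) ->
  exists a b a' b', [/\ a \in A, b \notin A, a' \in A & b' \notin A] /\
  \sum_w at_vertex f (u ++ v) w = f a a2 b2 + f a2 b2 b + f b' b1 a1 + f b1 a1 a'.
  move=> fA fB; exists (nth x0 u (size u).-2), (nth x0 v 1), (nth x0 u 1), (nth x0 v (size v).-2).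
  split; first by split; [exact: mu|exact: mv|exact: mu|exact: mv].
  rewrite sum_at_vertexE // (at_vertex_sumE x0) ?size_cat //.
  have -> : take 2 (u ++ v) = [:: nth x0 u 0; nth x0 u 1].
    by case: (u) su => [|c1 [|c2 q]] //= _; rewrite take0.
  rewrite -catA (tri_cat x0 f su) ?size_cat ?addn2 // (tri_cat x0 f sv) //.
  rewrite tri2 (tri_homogeneous (B := mem A) fA uA) (tri_homogeneous (B := [predC A]) _ vA) //.
  by rewrite lu lv !nth_cat v0 sv !add0n !addn0 !addnA.
exists (u ++ v); apply: valid_of_sums => //.
  have [||a [b [a' [b' [[h1 h2 h3 h4] ->]]]]] := sumE (improper adj K).
  - by move=> a w b h1 h2 h3; rewrite /improper !KA.
  - by move=> a w b h1 h2 h3; rewrite /improper !KB.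
  rewrite /improper (KA a2 a) // (KB b2 b) // (KB b1 b') // (KA a1 a') // ab1 ab2.
  by rewrite (adj_sym b2 a2) ab2 (adj_sym b1 a1) ab1 !orbT.
have [||a [b [a' [b' [[h1 h2 h3 h4] ->]]]]] := sumE (nonK K).
- by move=> a w b h1 h2 h3; rewrite /nonK !KA.
- by move=> a w b h1 h2 h3; rewrite /nonK !KB.
rewrite /nonK (KA a2 a) // (KB b2 b) // (KB b1 b') // (KA a1 a') //.
by case: (K _ _); case: (K _ _); case: (K _ _); case: (K _ _).
Qed.

Hypothesis adj_irr : irreflexive adj.
Hypothesis dirac : forall v, #|T| <= 2 * #|[set u | adj v u]|.

Lemma deg_split (A : {set T}) v :
  #|[set u | adj v u]| = #|[set u in A | adj v u]| + #|[set u in ~: A | adj v u]|.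
Proof.
rewrite -(cardsID A [set u | adj v u]); congr (_ + _); apply: eq_card => u; rewrite !inE andbC //.
Qed.

Lemma crossing_neighbour (A : {set T}) a : a \in A -> 2 * #|A| <= #|T| ->
  exists2 b, b \notin A & adj a b.
Proof.
move=> aA hA.
have h : #|[set u in A | adj a u]| < #|A|.
  apply: proper_card; apply/properP; split; first by apply/subsetP => u; rewrite inE => /andP[].
  by exists a => //; rewrite inE adj_irr andbF.
have : 0 < #|[set u in ~: A | adj a u]|.
  by have := dirac a; rewrite (deg_split A); move: h hA; clear; lia.
by move=> /card_gt0P[b]; rewrite !inE => /andP[bA ab]; exists b.
Qed.

(** Vertices of [A] have neighbours outside. If [a] and [a'] both yield [b], an outer [c] other than
    [b] with a neighbour in [A], or a second outer neighbour of [a], gives disjoint edges. Failing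
    both, the degree of [a] forces [A] to contain half of the vertices, and then [c] has a neighbour
    in [A] after all. *)
Lemma two_crossing_edges (A : {set T}) : 2 * #|A| <= #|T| -> 1 < #|A| -> 1 < #|~: A| ->
  exists a1 a2 b1 b2, [/\ [/\ a1 \in A, a2 \in A & a1 != a2],
    [/\ b1 \notin A, b2 \notin A & b1 != b2], adj a1 b1 & adj a2 b2].
Proof.
move=> hA A1 B1; have /card_gt1P[a [a' [aA a'A aa']]] := A1.
have [b bA ab] := crossing_neighbour aA hA.
have [b' b'A a'b'] := crossing_neighbour a'A hA.
have [e|ne] := eqVneq b b'; last by exists a, a', b, b'.
subst b'.
have [c cA bc] : exists2 c, c \notin A & b != c.
  have [c] : exists c, c \in ~: A :\ b.
    by apply/card_gt0P; have := cardsD1 b (~: A); rewrite inE bA; lia.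
  by rewrite !inE => /andP[cb cA]; exists c; rewrite // eq_sym.
have step v w : v \in A -> w \in A -> v != w -> adj v b -> adj w b -> adj v c ->
  exists a1 a2 b1 b2, [/\ [/\ a1 \in A, a2 \in A & a1 != a2],
    [/\ b1 \notin A, b2 \notin A & b1 != b2], adj a1 b1 & adj a2 b2].
  by move=> *; exists v, w, c, b; split=> //; split=> //; rewrite eq_sym.
have [ac|nac] := boolP (adj a c); first exact: (step a a').
have [a'c|na'c] := boolP (adj a' c); first by apply: (step a' a); rewrite // eq_sym.
have [/existsP[d /and3P[dA da dc]]|/existsPn nd] :=
  boolP [exists d, [&& d \in A, adj d b || ~~ adj d b & adj d c]].
  by exists d, a, c, b; split=> //; split=> //; rewrite ?(eq_sym c) //; apply: contraNneq nac => <-.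
have [/existsP[d /and3P[d1 d2 d3]]|/existsPn nd'] :=
  boolP [exists d, [&& d \notin A, d != b & adj a d]].
  by exists a, a', d, b; split=> //; split=> //; rewrite eq_sym.
have h1 : 2 * #|A| >= #|T|.
  have : #|[set u in ~: A | adj a u]| <= 1.
    apply: leq_trans (_ : #|[set b]| <= 1); last by rewrite cards1.
    apply: subset_leq_card; apply/subsetP => u; rewrite !inE => /andP[uA au].
    by have := nd' u; rewrite uA au andbT /= negbK.
  have h : #|[set u in A | adj a u]| < #|A|.
    apply: proper_card; apply/properP; split; first by apply/subsetP => u; rewrite inE => /andP[].
    by exists a => //; rewrite inE adj_irr andbF.
  by have := dirac a; rewrite (deg_split A); move: h; clear; lia.
have cA' : c \in ~: A by rewrite inE.
have [|d] := crossing_neighbour cA'; first by have := cardsC A; move: h1; clear; lia.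
by rewrite inE negbK adj_sym => dA dc; have := nd d; rewrite dA dc orbN.
Qed.

(** If [r] edges covering [V] cannot be extended, every edge inside [A] meets [V]. Let [s] be the
    surplus of [A]. Each vertex of [A] has at least [s / 2] neighbours in [A], so [V] receives at
    least [(#|A| - 2 * r) * s / 2] edges, but at most [2 * r * #|T| / 16]. This contradicts [r < s],
    [8 * s <= #|T|] and [#|T| <= 2 * #|A|]. For [r = 0] the set [V] is empty, which settles a
    surplus of 1. *)
Lemma matching_inside (A : {set T}) r : #|~: A| <= #|A| -> r + #|~: A| <= #|A| ->
  8 * (#|A| - #|~: A|) <= #|T| ->
  (#|A| <= #|~: A| + 1 \/ forall v, v \in A -> 16 * #|[set u in A | adj v u]| <= #|T|) ->
  exists M : seq (T * T), [/\ size M = r, uniq (unzip1 M ++ unzip2 M) &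
    all (fun p => [&& p.1 \in A, p.2 \in A & adj p.1 p.2]) M].
Proof.
move=> AB; elim: r => [|r IH] hr hs hd; first by exists [::].
have [|M [sM uM aM]] := IH _ hs hd; first by move: hr; clear; lia.
pose V := [set v in unzip1 M ++ unzip2 M].
have VA : V \subset A.
  apply/subsetP => v; rewrite inE mem_cat => /orP[] /mapP[p pM ->];
    by have /and3P[] := allP aM p pM.
have cV : #|V| = 2 * r by rewrite cardsE (card_uniqP uM) size_cat !size_map sM mul2n addnn.
have [/existsP[u /existsP[v /and5P[uA uV vA vV uv]]]|none] :=
  boolP [exists u, exists v, [&& u \in A, u \notin V, v \in A, v \notin V & adj u v]].
  exists ((u, v) :: M); split; [by rewrite /= sM| |by rewrite /= uA vA uv].
  have pe : perm_eq (unzip1 ((u, v) :: M) ++ unzip2 ((u, v) :: M)) (u :: v :: unzip1 M ++ unzip2 M).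
    by apply/permP => P; rewrite /= !count_cat /=; clear; lia.
  rewrite (perm_uniq pe) /= uM andbT; rewrite !inE in uV vV; rewrite inE negb_or uV vV !andbT.
  by apply: contraTneq uv => ->; rewrite adj_irr.
pose d v := #|[set u in A | adj v u]|.
have dmin v : #|A| - #|~: A| <= 2 * d v.
  have := dirac v; rewrite (deg_split A) -/(d v) -(cardsC A).
  have : #|[set u in ~: A | adj v u]| <= #|~: A|.
    by apply: subset_leq_card; apply/subsetP => w; rewrite inE => /andP[].
  by clear; lia.
have dbl : \sum_(v in A :\: V) d v <= \sum_(u in V) d u.
  have -> : \sum_(v in A :\: V) d v = \sum_(v in A :\: V) \sum_(u in V) adj v u.
    apply: eq_bigr => v; rewrite inE => /andP[vV vA].
    rewrite /d -sum1dep_card big_mkcond [RHS]big_mkcond; apply: eq_bigr => u _ /=.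
    case uA: (u \in A); case uV: (u \in V) => //=.
      case uv: (adj v u) => //; case/negP: none; apply/existsP; exists u; apply/existsP; exists v.
      by rewrite uA uV vA vV adj_sym uv.
    by move: uA; rewrite (subsetP VA u uV).
  rewrite exchange_big /=; apply: leq_sum => u uV.
  rewrite /d -sum1dep_card big_mkcond [X in _ <= X]big_mkcond; apply: leq_sum => v _ /=.
  by rewrite inE adj_sym; case: (v \in V); case: (v \in A); case: (adj u v).
have lower : (#|A| - 2 * r) * (#|A| - #|~: A|) <= 2 * \sum_(u in V) d u.
  rewrite -cV -(cardsDS VA) -sum_nat_const.
  apply: leq_trans (leq_mul (leqnn 2) dbl); rewrite big_distrr /=.
  by apply: leq_sum => v _.
have [r0|r0] := posnP r.
  move: lower; rewrite big1 => [|u uV]; last first.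
    have : #|V| = 0 by rewrite cV r0.
    by move=> /cards0_eq V0; rewrite V0 inE in uV.
  rewrite muln0 leqn0 muln_eq0 r0 muln0 subn0; move: hr; clear; lia.
case: hd => hd; first by move: hr hd r0; clear; lia.
have upper : 16 * \sum_(u in V) d u <= 2 * r * #|T|.
  rewrite big_distrr -cV -sum_nat_const /=; apply: leq_sum => u uV.
  by apply: hd; apply: (subsetP VA).
have h1 : 16 * ((#|A| - 2 * r) * (#|A| - #|~: A|)) <= 4 * r * #|T|.
  apply: leq_trans (leq_mul (leqnn 16) lower) _; rewrite mulnCA.
  by apply: leq_trans (leq_mul (leqnn 2) upper) _; rewrite !mulnA.
have h2 : 16 * ((#|A| - 2 * r) * (#|A| - #|~: A|)) <= (#|A| - #|~: A|) * (4 * #|T|).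
  apply: leq_trans h1 _; rewrite -mulnA mulnCA leq_mul2r; apply/orP; right.
  by move: hr; clear; lia.
have s0 : 0 < #|A| - #|~: A| by move: hr; clear; lia.
move: h2; rewrite mulnA mulnC leq_pmul2l //.
by have := cardsC A; move: hr hs AB r0; clear; lia.
Qed.

End Orders.

Lemma valid_leq (T : finType) (adj K : rel T) m m' s : m <= m' -> valid adj K m s -> valid adj K m' s.
Proof. by move=> mm [ps impr nKm]; split=> //; apply: leq_trans mm. Qed.

(** * A robust relation with a valid order for extremal graphs *)

Section ExtremalRoute.
Variables (T : finType) (x0 : T) (adj : rel T).
Hypothesis adj_sym : symmetric adj.
Hypothesis adj_irr : irreflexive adj.
Let n := #|T|.
Hypothesis dirac : forall v, n <= 2 * #|[set u | adj v u]|.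

Definition route (m : nat) := exists K : rel T,
  [/\ symmetric K, robust x0 adj K 2500 m & exists s, valid adj K m s].

(** One of the truncated differences is zero, so this is the absolute difference. *)
Definition imbalance (A : {set T}) := (#|A| - #|~: A|) + (#|~: A| - #|A|).

Lemma symdiffC (A X : {set T}) : symdiff (~: A) (~: X) = symdiff A X.
Proof. by apply/setP => v; rewrite !in_symdiff !inE; case: (v \in A); case: (v \in X). Qed.

Lemma fitsC (X A : {set T}) c : fits adj X c A -> fits adj (~: X) c (~: A).
Proof.
move=> h v; apply: leq_trans (h v) _; rewrite leq_mul2l /=; apply: subset_leq_card.
by apply/subsetP => k; rewrite !inE; case: (v \in A); case: (k \in X).
Qed.

Lemma imbalanceC A : imbalance (~: A) = imbalance A.
Proof. by rewrite /imbalance setCK addnC. Qed.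

Section Sides.
Variables (X W : {set T}) (c : bool) (e : nat).
Hypothesis typ : forall v, v \notin W -> #|[set u | side X c v u && ~~ adj v u]| <= e.
Hypotheses (We : #|W| <= e) (e0 : 0 < e) (en : 200 * (e + 8 * e) <= n).

Lemma clique_route A : c = false -> fits adj X c A -> #|symdiff A X| <= e ->
  n <= 2 * #|X| + e -> 2 * #|X| <= n + e -> route (8 * e).
Proof.
move=> cF fA dA nX Xn; exists (side A c); split; first exact: side_sym.
  by apply: (@fits_robust T x0 adj X W c e typ A (8 * e) (8 * e) We fA); move: dA en; rewrite -/n; clear; lia.
have h1 : #|A| <= #|X| + e.
  have := card_leqD A X; have := subset_leq_card (subsetUl (A :\: X) (X :\: A)).
  by rewrite -/(symdiff A X); move: dA; clear; lia.
have h2 : #|X| <= #|A| + e.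
  have := card_leqD X A; have := subset_leq_card (subsetUr (A :\: X) (X :\: A)).
  by rewrite -/(symdiff A X); move: dA; clear; lia.
have hC := cardsC A.
have A1 : 1 < #|A| by move: h1 h2 nX Xn en e0; rewrite -/n; clear; lia.
have B1 : 1 < #|~: A| by move: h1 h2 nX Xn en e0 hC; rewrite -/n; clear; lia.
have [s vs] : exists s, valid adj (side A c) 4 s.
  rewrite cF; case: (leqP #|A| #|~: A|) => h.
    have [|//|//|a1 [a2 [b1 [b2 [[? ? ?] [? ? ?] ab1 ab2]]]]] :=
      @two_crossing_edges T adj adj_sym adj_irr dirac A.
      by rewrite -hC; move: h; clear; lia.
    exact: (two_cliques_order x0 adj_sym (a1 := a1) (a2 := a2) (b1 := b1) (b2 := b2)).
  have [|//||a1 [a2 [b1 [b2 [[u1 u2 u3] [w1 w2 w3] ab1 ab2]]]]] :=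
      @two_crossing_edges T adj adj_sym adj_irr dirac (~: A).
  - by rewrite -hC; move: h; clear; lia.
  - by rewrite setCK.
  rewrite !inE ?negbK in u1 u2 w1 w2.
  by apply: (two_cliques_order x0 adj_sym (a1 := b1) (a2 := b2) (b1 := a1) (b2 := a2)) => //;
    rewrite adj_sym.
by exists s; apply: valid_leq vs; move: e0; clear; lia.
Qed.

(** If the surplus of [A] exceeds 1, moving [v] out of [A] lowers [imbalance] by 2 and raises the
    distance to [X] by at most 1, so by minimality the result does not fit. Other vertices are
    unaffected, hence [v] has fewer than [n / 20] neighbours in [X] and at most [n / 16] in [A], as
    [matching_inside] requires. At most [4 * e] matching edges, counted twice, give [8 * e]. *)
Lemma bipartite_route A : c = true -> fits adj X c A ->
  imbalance A + #|symdiff A X| <= 4 * e ->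
  (forall B, fits adj X c B -> imbalance A + #|symdiff A X| <= imbalance B + #|symdiff B X|) ->
  #|~: A| <= #|A| -> route (8 * e).
Proof.
move=> cT fA pA minA AB; exists (side A c); split; first exact: side_sym.
  by apply: (@fits_robust T x0 adj X W c e typ A (8 * e) (8 * e) We fA); move: pA en; rewrite -/n; clear; lia.
have hC := cardsC A.
have imb : #|A| - #|~: A| <= 4 * e by move: pA; rewrite /imbalance; clear; lia.
have [|||M [sM uM aM]] := @matching_inside T adj adj_sym adj_irr dirac A (#|A| - #|~: A|) AB.
- by move: AB; clear; lia.
- by move: imb en; rewrite -/n; clear; lia.
- case: (leqP #|A| (#|~: A| + 1)) => h; [by left|right] => v vA.
  have hv : 20 * #|[set k | adj v k && (k \in X)]| < n.
    rewrite ltnNge; apply/negP => hv.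
    have fB : fits adj X c (A :\ v).
      move=> u; rewrite !inE; case: (eqVneq u v) => [->|uv] /=; last exact: fA.
      apply: leq_trans hv _; rewrite leq_mul2l /=; apply: subset_leq_card.
      by apply/subsetP => k; rewrite !inE cT; case: (k \in X); rewrite ?andbF.
    have := minA _ fB; have c1 := cardsD1 v A; rewrite vA in c1.
    have c2 := cardsC (A :\ v).
    have c3 : #|symdiff (A :\ v) X| <= #|symdiff A X| + 1.
      rewrite -(cards1 v); apply: leq_trans (leq_card_setU _ _); apply: subset_leq_card.
      apply/subsetP => u; rewrite in_setU !in_symdiff !inE.
      by case: (eqVneq u v) => [_|_] /=; rewrite ?orbT ?orbF.
    by rewrite /imbalance; move: c1 c2 c3 hC h; rewrite -/n; clear; lia.
  have : [set u in A | adj v u] \subset [set k | adj v k && (k \in X)] :|: symdiff A X.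
    apply/subsetP => u; rewrite in_setU in_symdiff !inE => /andP[-> ->].
    by case: (u \in X).
  move=> /subset_leq_card /leq_trans /(_ (leq_card_setU _ _)).
  by move: hv pA en; rewrite -/n; clear; lia.
have [||s vs] := @bipartite_order T x0 adj adj_sym A M _ _ uM aM.
- by rewrite sM; move: AB; clear; lia.
- by move: hC imb en e0; rewrite -/n; clear; lia.
by exists s; rewrite cT; apply: valid_leq vs; rewrite sM; move: imb; clear; lia.
Qed.

End Sides.

Lemma extremal_route (X X1 : {set T}) (c : bool) r e :
  X1 \subset X -> #|X :\: X1| <= r -> n <= 2 * #|X| -> 2 * #|X| <= n + 12 * r ->
  (forall a, a \in X1 -> #|[set k | adj a k && ((k \in X) == c)]| <= 6 * r) ->
  0 < e -> 12 * r <= e -> 48 * (r * n) <= e * e -> 200 * (e + 8 * e) <= n ->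
  route (8 * e).
Proof.
move=> X1X XX1 nX Xn few e0 re rne en.
have [We typ] := typical adj_sym dirac X1X XX1 nX Xn few e0 re rne.
set W := [set v | _] in We typ.
have [|||A0 [fA0 dA0]] := fits_exists typ dirac.
- by move: nX; rewrite -/n; clear; lia.
- by move: Xn re; rewrite -/n; clear; lia.
- by move: en; rewrite -/n; clear; lia.
have dA0e := leq_trans (subset_leq_card dA0) We.
have [cT|cF] : c = true \/ c = false by case: (c); [left|right].
  2: by apply: (clique_route typ We e0 en cF fA0 dA0e); move: nX Xn re; clear; lia.
pose fb (A : {set T}) := [forall v, n <= 20 * #|[set k | adj v k && (((v \in A) == (k \in X)) (+) c)]|].
pose phi A := imbalance A + #|symdiff A X|.
have fbP A : reflect (fits adj X c A) (fb A) by exact: forallP.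
have f0 : fb A0 by exact/fbP.
case: (@arg_minnP _ A0 fb phi f0) => A /fbP fA minA.
(* For [A0] the distance to [X] is at most [e], which adds [2 * e] to the imbalance; the size of [X]
   adds [12 * r <= e]. *)
have pA : phi A <= 4 * e.
  apply: leq_trans (minA A0 f0) _.
  have h1 : #|A0| <= #|X| + e.
    have := card_leqD A0 X; have := subset_leq_card (subsetUl (A0 :\: X) (X :\: A0)).
    by rewrite -/(symdiff A0 X); move: dA0e; clear; lia.
  have h2 : #|X| <= #|A0| + e.
    have := card_leqD X A0; have := subset_leq_card (subsetUr (A0 :\: X) (X :\: A0)).
    by rewrite -/(symdiff A0 X); move: dA0e; clear; lia.
  have := cardsC A0; rewrite /phi /imbalance -/n.
  by move: h1 h2 nX Xn re dA0e; clear; lia.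
case: (leqP #|~: A| #|A|) => h.
  by apply: (bipartite_route typ We e0 en cT fA pA) => // B /fbP /minA.
(* Complementing both [X] and [A] preserves [side], [fits] and minimality, so the larger class may
   play the role of [A]. *)
apply: (@bipartite_route (~: X) W c e _ We e0 en (~: A)) => //.
- move=> v /typ; apply: leq_trans; apply: subset_leq_card; apply/subsetP => k.
  by rewrite !inE /side !inE; case: (v \in X); case: (k \in X).
- exact: fitsC.
- by rewrite imbalanceC symdiffC.
- move=> B /fitsC; rewrite setCK imbalanceC symdiffC => /fbP /minA; rewrite /phi => hB.
  by apply: leq_trans hB _; rewrite imbalanceC -(symdiffC (~: B)) setCK.
- by rewrite setCK ltnW.
Qed.

End ExtremalRoute.

(** * The cases of few and of many switches combined *)

Lemma compatible_order (T : finType) (x0 : T) (adj : rel T) (F : T -> rel T) (C k e1 h r e : nat) :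
  symmetric adj -> irreflexive adj -> (forall v, #|T| <= 2 * #|[set u | adj v u]|) ->
  (forall v u w, F v u w = F v w u) -> (forall v u, #|[set w | F v u w]| <= k) ->
  [/\ 48 <= e1, 30 * C * e1 < #|T|, k <= e1 & 8 * #|T| * k <= e1 * e1] ->
  [/\ 48 <= 8 * e, 30 * 2500 * (8 * e) < #|T|, k <= 8 * e & 8 * #|T| * k <= 8 * e * (8 * e)] ->
  [/\ #|T| * #|T| <= C * (h * h), 5 <= h, 20 * #|T| * h <= r * r & 8 * r <= #|T|] ->
  [/\ 12 * r <= e, 48 * (r * #|T|) <= e * e & 200 * (e + 8 * e) <= #|T|] ->
  exists K m s, valid adj K m s /\ weight adj F s = 0.
Proof.
move=> adj_sym adj_irr dirac F_sym Fk [e1a e1b e1c e1d] [ea eb ec ed] [hC h5 hr rn] [re rne en].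
have Fl m : k <= m -> forall v u, #|[set w | F v u w]| <= m by move=> km v u; apply: leq_trans km.
pose full : rel T := fun _ _ => true.
(* Orders are taken as tuples, a finite type, which makes the case distinction decidable. *)
have [/existsP[t /andP[pt ft]]|/existsPn many] :=
    boolP [exists t : #|T|.-tuple T, perm_eq t (enum T) && (#|switches x0 adj full t| <= h * h)].
  have [X [X1 [c [X1X XX1 nX Xn few]]]] :=
    extremal_structure adj_sym dirac pt h5 hr rn ft.
  have e0 : 0 < e by move: ea; clear; lia.
  have [K [K_sym rob [s vs]]] :=
    @extremal_route T x0 adj adj_sym adj_irr dirac X X1 c r e X1X XX1 nX Xn few e0 re rne en.
  have [||s' [vs' ws']] := @weight_zero T x0 adj K F adj_sym K_sym F_sym _ _ (8 * e) rob
    _ _ eb (Fl _ ec) k Fk ea ed s vs.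
  - by move: e0; clear; lia.
  - by [].
  by exists K, (8 * e), s'.
have vs : valid adj full 0 (enum T) by split=> //; apply/eqP; rewrite ?big1.
have rob : robust x0 adj full C 0.
  move=> s [ps _ _] _; apply: leq_trans hC _; rewrite leq_mul2l; apply/orP; right.
  have sz : size s == #|T| by rewrite (perm_size ps) cardT.
  by have := many (Tuple sz); rewrite /= ps /= -ltnNge => /ltnW.
have [||s' [vs' ws']] := @weight_zero T x0 adj full F adj_sym (fun _ _ => erefl) F_sym _ _ e1 rob
  _ _ e1b (Fl _ e1c) k Fk e1a e1d _ vs.
- by move: e1a; clear; lia.
- by [].
by exists full, 0, s'.
Qed.

Lemma hamilton_of_weight0 n (adj : rel 'I_n) (F : 'I_n -> rel 'I_n) K m s : 3 <= n ->
  valid adj K m s -> weight adj F s = 0 -> hamilton_cycle adj s /\ compatible_cycle F s.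
Proof.
move=> n3 [ps _ _] /eqP; rewrite sum_nat_eq0 => /forallP ds.
have us : uniq s by rewrite (perm_uniq ps) enum_uniq.
split.
  split=> //; first by rewrite (perm_size ps) -cardE card_ord.
  apply: (cycle_from_next us) => v _; have /eqP := ds v; rewrite /at_vertex /defect.
  by case: (adj v (next s v)) => //; rewrite addn1.
move=> v _; have /eqP := ds v; rewrite /at_vertex /defect.
by case: (F v _ _).
Qed.

(** * Choice of the constants *)

Lemma quotient_scale d c e n : 0 < d -> 0 < n -> n <= c * e -> 2 * d * c * c <= n ->
  n <= 2 * d * c * c * (e * e %/ (d * n)).
Proof.
move=> d0 n0 nce big.
have dn : 0 < d * n by rewrite muln_gt0 d0.
set q := e * e %/ (d * n).
have h1 : e * e < (q + 1) * (d * n) by rewrite addn1 -ltn_divLR.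
have h2 : n * n <= c * c * (e * e) by have := leq_mul nce nce; rewrite mulnACA.
have c0 : 0 < c * c.
  by rewrite lt0n; apply: contraTneq h2 => ->; rewrite -ltnNge muln_gt0 n0.
have h3 : n * n < c * c * ((q + 1) * (d * n)).
  by apply: leq_ltn_trans h2 _; rewrite ltn_pmul2l.
have h4 : n < c * c * d * (q + 1).
  rewrite -(ltn_pmul2r n0); apply: leq_trans h3 _.
  by rewrite -!mulnA leq_mul2l leq_mul2l; apply/orP; right; apply/orP; right; nia.
have q0 : 0 < q.
  rewrite lt0n; apply: contraTneq h4 => ->; rewrite -leqNgt.
  by apply: leq_trans big; nia.
by move: h4 q0; clear; nia.
Qed.

Lemma div_scale c n : 0 < c -> c <= n -> n <= 2 * c * (n %/ c).
Proof.
move=> c0 cn; have h := ltn_ceil n c0; have h0 : 0 < n %/ c by rewrite divn_gt0.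
apply: leq_trans (ltnW h) _; rewrite mulnC -mulnA mulnCA leq_mul2l.
by move: h0; clear; lia.
Qed.

Lemma scale_lower c n q m : 0 < c -> n <= c * q -> c * m <= n -> m <= q.
Proof. by move=> c0 h1 h2; rewrite -(leq_pmul2l c0); apply: leq_trans h1. Qed.

Lemma conflict_scale c E n M k : 0 < c -> 0 < n -> n <= c * E -> 8 * c * c <= M -> M * k <= n ->
  k <= E /\ 8 * n * k <= E * E.
Proof.
move=> c0 n0 nE cM Mk; split.
  rewrite -(leq_pmul2l c0); apply: leq_trans nE; apply: leq_trans Mk; rewrite leq_mul2r.
  by apply/orP; right; apply: leq_trans cM; rewrite -mulnA mulnCA leq_pmulr // muln_gt0.
have cc : 0 < c * c by rewrite muln_gt0 c0.
rewrite -(leq_pmul2l cc).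
have h1 : n * (8 * c * c * k) <= n * n.
  by rewrite leq_mul2l; apply/orP; right; apply: leq_trans Mk; rewrite leq_mul2r cM orbT.
have h2 : n * n <= c * c * (E * E) by have := leq_mul nE nE; rewrite mulnACA.
by apply: leq_trans (leq_trans h1 h2); move: (c) (n) (k); clear; lia.
Qed.

(** All of [e], [r], [h], [e1] are linear in [n]. They are fixed in the order [e], [r], [h], where
    [r] and [h] are the largest values that the quadratic constraints allow; then [C] comes from
    [h], [e1] is small against [n / C], and [M] is chosen last. *)
Lemma scales : exists C M n0, 0 < M /\ forall n k, n0 <= n -> M * k <= n ->
  exists e1 h r e,
  [/\ [/\ 48 <= e1, 30 * C * e1 < n, k <= e1 & 8 * n * k <= e1 * e1],
  [/\ 48 <= 8 * e, 30 * 2500 * (8 * e) < n, k <= 8 * e & 8 * n * k <= 8 * e * (8 * e)],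
  [/\ n * n <= C * (h * h), 5 <= h, 20 * n * h <= r * r & 8 * r <= n] &
  [/\ 12 * r <= e, 48 * (r * n) <= e * e & 200 * (e + 8 * e) <= n]].
Proof.
(* Only the defining relations of these constants are kept; their values are too large to compute
   with. *)
have [c0 hc0] : exists c0, 30 * 2500 * 8 < c0 by exists (30 * 2500 * 8).+1; exact: ltnSn.
have [ce ceE] : exists x, x = 2 * c0 by eexists.
have [cr crE] : exists x, x = 2 * 48 * ce * ce by eexists.
have [ch chE] : exists x, x = 2 * 20 * cr * cr by eexists.
have [q qE] : exists x, x = (30 * (ch * ch)).+1 by eexists.
have [c cE] : exists x, x = 2 * q + ce by eexists.
have c0p : 0 < c0 by apply: leq_trans hc0.
have cep : 0 < ce by rewrite ceE muln_gt0.
have crp : 0 < cr by rewrite crE !muln_gt0 cep.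
have chp : 0 < ch by rewrite chE !muln_gt0 crp.
have qp : 0 < q by rewrite qE.
have cp : 0 < c by rewrite cE addn_gt0 cep orbT.
exists (ch * ch), (8 * c * c), (c0 + cr + ch + q + 2 * q * 48 + ch * 5 + ce * 48).
split; first by rewrite !muln_gt0 cp.
move=> n k hn Mk.
have [n0 [g0 gr gh] [gq gq48] gh5 ge48] : [/\ 0 < n, [/\ c0 <= n, cr <= n & ch <= n],
    q <= n /\ 2 * q * 48 <= n, ch * 5 <= n & ce * 48 <= n].
  by move: hn qp; clear; split; [lia|split; lia|lia..].
have [e eE] : exists x, x = n %/ c0 by eexists.
have [e1 e1E] : exists x, x = n %/ q by eexists.
have [r rE] : exists x, x = e * e %/ (48 * n) by eexists.
have [h hE] : exists x, x = r * r %/ (20 * n) by eexists.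
have nce : n <= ce * e by rewrite eE ceE div_scale.
have nq : n <= 2 * q * e1 by rewrite e1E div_scale.
have ncr : n <= cr * r by rewrite rE crE; apply: quotient_scale; rewrite -?crE.
have nch : n <= ch * h by rewrite hE chE; apply: quotient_scale; rewrite -?chE.
have e48 : 48 <= e by apply: scale_lower nce ge48.
have e148 : 48 <= e1 by apply: scale_lower nq gq48; rewrite muln_gt0.
have h5 : 5 <= h by apply: scale_lower nch gh5.
have en : c0 * e <= n by rewrite eE mulnC leq_trunc_div.
have e1n : q * e1 <= n by rewrite e1E mulnC leq_trunc_div.
have rn : 48 * n * r <= e * e by rewrite rE mulnC leq_trunc_div.
have hn' : 20 * n * h <= r * r by rewrite hE mulnC leq_trunc_div.
have en1 : e <= n by apply: leq_trans en; rewrite leq_pmull.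
have Mc1 : 8 * (2 * q) * (2 * q) <= 8 * c * c.
  by apply: leq_mul; [apply: leq_mul|]; rewrite // cE leq_addr.
have Mce : 8 * ce * ce <= 8 * c * c.
  by apply: leq_mul; [apply: leq_mul|]; rewrite // cE leq_addl.
have [k1 kn1] := conflict_scale (ltac:(by rewrite muln_gt0) : 0 < 2 * q) n0 nq Mc1 Mk.
have [k2 kn2] := conflict_scale cep n0 nce Mce Mk.
have e8 : 30 * 2500 * 8 * e < n.
  by apply: leq_trans en; rewrite ltn_mul2r hc0 andbT; apply: leq_trans e48.
have r48 : 48 * r <= e.
  rewrite -(leq_pmul2l n0); apply: (@leq_trans (e * e)); last by rewrite leq_mul2r en1 orbT.
  by rewrite mulnCA mulnA.
exists e1, h, r, e; split; split => //.
- by apply: leq_trans e1n; rewrite qE ltn_mul2r ltnSn andbT; apply: leq_trans e148.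
- by move: e48; clear; lia.
- by rewrite mulnA.
- by move: k2; clear; lia.
- by apply: leq_trans kn2 _; apply: leq_mul; rewrite leq_pmull.
- by have := leq_mul nch nch; rewrite mulnACA.
- by move: r48 en1; clear; lia.
- by move: r48; clear; lia.
- by rewrite (mulnC r) mulnA.
- by move: e8; clear; lia.
Qed.

From Stdlib Require Import Reals.

Lemma INR_leq m n : (INR m <= INR n)%R -> m <= n.
Proof. by move=> /INR_le /leP. Qed.

Theorem theorem1p3 :
  exists mu : R, (0 < mu)%R /\
  exists n0 : nat, forall n : nat, n0 <= n ->
  forall (adj : rel 'I_n), simple_graph adj ->
  (forall v : 'I_n, (INR n <= 2 * INR (deg adj v))%R) ->
  forall F : 'I_n -> rel 'I_n, incompat_system adj F ->
  delta_bounded F (mu * INR n)%R ->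
  exists s : seq 'I_n, hamilton_cycle adj s /\ compatible_cycle F s.
Proof.
have [C [M [n0 [M0 scal]]]] := scales.
have MR : (0 < INR M)%R by apply: lt_0_INR; apply/ltP.
(* With [mu = 1 / M] the conflict counts, being integers, are at most [n %/ M]. *)
exists (/ INR M)%R; split; first exact: Rinv_0_lt_compat.
exists (n0 + 3) => n hn adj [adj_sym adj_irr] dirac F [F_sym _] Fb.
have n3 : 3 <= n := leq_trans (leq_addl _ _) hn.
pose x0 : 'I_n := Ordinal (leq_trans (isT : 0 < 3) n3).
have Fk v u : #|[set w | F v u w]| <= n %/ M.
  rewrite leq_divRL //; apply: INR_leq; rewrite mult_INR.
  apply: (Rle_trans _ (/ INR M * INR n * INR M)); last first.
    by right; field; apply: Rgt_not_eq.
  by apply: Rmult_le_compat_r; [apply: Rlt_le | apply: Fb].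
have dirac' v : #|'I_n| <= 2 * #|[set u | adj v u]|.
  by rewrite card_ord; apply: INR_leq; rewrite mult_INR; apply: dirac.
have [||e1 [h [r [e [s1 s2 s3 s4]]]]] := scal #|'I_n| (n %/ M); rewrite ?card_ord.
- exact: leq_trans (leq_addr _ _) hn.
- by rewrite mulnC leq_trunc_div.
have adj_irr' : irreflexive adj by move=> v; apply/negbTE.
have [K [m [s [vs ws]]]] :=
  compatible_order x0 adj_sym adj_irr' dirac' F_sym Fk s1 s2 s3 s4.
by exists s; apply: hamilton_of_weight0 vs ws.
Qed.
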